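(* Let $T$ be a complete first-order theory with monster model $\mathfrak{C}$, $A\subseteq\mathfrak{C}$ a small set and $\alpha$ a small ordinal (no countability is assumed). Suppose that: (1) $X\subseteq\mathfrak{C}^\alpha$ is type definable over $A$. (2) $E$ is a pseudo $F_\sigma$, $\emptyset$-invariant equivalence relation on $X$ with normal form $\langle U_n\mid n<\omega\rangle$, and $E$ is bounded on $X$. (3) $C\subseteq X$ is an $E$-class, and $E\upharpoonright C$ is not strongly closed with respect to $\langle U_n\mid n<\omega\rangle$, i.e. there is no $n<\omega$ with $E\cap C^2=U_n\cap C^2$. (4) $C\subseteq Y\subseteq X$, where $Y$ is pseudo strong Choquet and $E$-invariant (a union of $E$-classes). (5) $\Gamma\leq\operatorname{Aut}(\mathfrak{C})$ is $C$-transitive (for all $a,b\in C$ there is $\sigma\in\Gamma$ with $\sigma(a)=b$) and preserves all $E$-classes (in particular, it preserves $X$). Then $E\upharpoonright Y$ has at least $2^{\aleph_0}$ classes.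
   Context: $\mathfrak{C}$ is a monster model of $T$: $\kappa$-saturated and $\kappa$-homogeneous for a big cardinal $\kappa$ (in particular $\kappa$ is much larger than the size of the language). ''Small'' means of cardinality $<\kappa$; all parameter sets and models ($M\prec\mathfrak{C}$) are small. A subset of $\mathfrak{C}^\alpha$ is pseudo closed if it is type definable over some small set, and pseudo $F_\sigma$ if it is a countable union of pseudo closed sets. A set is $\emptyset$-invariant if it is invariant under $\operatorname{Aut}(\mathfrak{C})$. An $\emptyset$-invariant pseudo $F_\sigma$ equivalence relation on $X$ means an $\emptyset$-invariant pseudo $F_\sigma$ set $E\subseteq\mathfrak{C}^\alpha\times\mathfrak{C}^\alpha$ whose restriction to $X$ is an equivalence relation; it is bounded if $|X/E|<\kappa$. A normal form is a sequence of $\emptyset$-type definable sets $U_n\subseteq\mathfrak{C}^\alpha\times\mathfrak{C}^\alpha$ with $E=\bigcup_{n<\omega}U_n$, such that $U_0$ contains the diagonal of $X$, each $U_n$ is symmetric, and for all $a,b,c\in X$, $(a,c),(c,b)\in U_n$ implies $(a,b)\in U_{n+1}$. For a model $M$ and $Y\subseteq\mathfrak{C}^\alpha$, $Y_M=\{\operatorname{tp}(a/M)\mid a\in Y\}\subseteq S_\alpha(M)$ with the topology induced from the Stone space. $Y$ is pseudo strong Choquet if $Y_M$ is a strong Choquet space for every model $M$. The strong Choquet game on a topological space $Z$: in round $n<\omega$, player A chooses an open set $O_n\subseteq W_{n-1}$ (where $W_{-1}=Z$) and a point $x_n\in O_n$, and player B responds with an open set $W_n\subseteq O_n$ containing $x_n$;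 player B wins if $\bigcap_{n<\omega}W_n\neq\emptyset$. $Z$ is strong Choquet if player B has a winning strategy. *)

(* Defs.v *)
From HB Require Import structures.
From mathcomp Require Import all_boot all_order all_algebra.
From mathcomp Require Import all_classical all_reals all_analysis.

Set Implicit Arguments.
Unset Strict Implicit.
Unset Printing Implicit Defensive.

Local Open Scope classical_set_scope.
Local Open Scope card_scope.

(* A cardinal is represented by a type of that cardinality. *)
Definition card_lt (T U : Type) (A : set T) (B : set U) : Prop :=
  (A #<= B) && ~~ (B #<= A).

Definition small (kappa : Type) (T : Type) (A : set T) : Prop :=
  card_lt A [set: kappa].

Record language : Type := Language {
  fsym : Type;
  rsym : Type;
  fsym_arity : fsym -> nat;
  rsym_arity : rsym -> nat }.

Inductive term (L : language) (V : Type) : Type :=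
| tvar of V
| tfun (f : fsym L) of ('I_(fsym_arity f) -> term L V).

(* [form L V] is the type of formulas whose free variables are indexed by [V];
   under a quantifier, [None] is the bound variable. *)
Inductive form (L : language) (V : Type) : Type :=
| fbot
| feq of term L V & term L V
| frel (r : rsym L) of ('I_(rsym_arity r) -> term L V)
| fimp of form L V & form L V
| fall of form L (option V).

Arguments tvar {L V}.
Arguments tfun {L V}.
Arguments fbot {L V}.
Arguments feq {L V}.
Arguments frel {L V}.
Arguments fimp {L V}.
Arguments fall {L V}.

HB.instance Definition _ (L : language) (V : Type) := gen_eqMixin (form L V).
HB.instance Definition _ (L : language) (V : Type) :=
  gen_choiceMixin (form L V).
HB.instance Definition _ (L : language) (V : Type) :=
  isPointed.Build (form L V) fbot.

Definition fneg (L : language) (V : Type) (phi : form L V) : form L V :=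
  fimp phi fbot.

Record structure (L : language) : Type := Structure {
  carrier :> Type;
  carrier_inhabited : inhabited carrier;
  fint : forall f : fsym L, ('I_(fsym_arity f) -> carrier) -> carrier;
  rint : forall r : rsym L, ('I_(rsym_arity r) -> carrier) -> Prop }.

Arguments fint {L} s f _.
Arguments rint {L} s r _.

Fixpoint teval (L : language) (M : structure L) (V : Type) (e : V -> M)
    (t : term L V) : M :=
  match t with
  | tvar v => e v
  | tfun f args => fint M f (fun i => teval e (args i))
  end.

Fixpoint sat (L : language) (M : structure L) (V : Type) (phi : form L V) :
    (V -> M) -> Prop :=
  match phi with
  | fbot => fun=> False
  | feq t u => fun e => teval e t = teval e u
  | frel r args => fun e => rint M r (fun i => teval e (args i))
  | fimp phi1 phi2 => fun e => sat phi1 e -> sat phi2 e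
  | fall phi1 => fun e => forall x : M, sat phi1 (oapp e x)
  end.

Definition sentence (L : language) : Type := form L void.

Definition models (L : language) (M : structure L) (T : set (sentence L)) :
    Prop :=
  forall phi, T phi -> sat phi (of_void M).

Definition complete_theory (L : language) (T : set (sentence L)) : Prop :=
  (exists M : structure L, models M T) /\
  forall phi : sentence L,
    (forall M : structure L, models M T -> sat phi (of_void M)) \/
    (forall M : structure L, models M T -> sat (fneg phi) (of_void M)).

Definition automorphism (L : language) (M : structure L) (s : M -> M) : Prop :=
  [/\ bijective s,
      forall (f : fsym L) (args : 'I_(fsym_arity f) -> M),
        s (fint M f args) = fint M f (s \o args)
    & forall (r : rsym L) (args : 'I_(rsym_arity r) -> M),
        rint M r args <-> rint M r (s \o args)].

Definition aut_subgroup (L : language) (M : structure L) (G : set (M -> M)) :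
    Prop :=
  [/\ G `<=` @automorphism L M,
      G id,
      forall s t, G s -> G t -> G (s \o t)
    & forall s t, G s -> cancel s t -> cancel t s -> G t].

Record substructure (L : language) (M : structure L) : Type := Substructure {
  sub_dom :> set M;
  sub_nonempty : sub_dom !=set0;
  sub_fint : forall (f : fsym L) (args : 'I_(fsym_arity f) -> M),
    (forall i, sub_dom (args i)) -> sub_dom (fint M f args) }.

Section induced_structure.
Context (L : language) (M : structure L) (N : substructure M).

Lemma induced_inhabited : inhabited (set_type N).
Proof. by have [x Nx] := sub_nonempty N; constructor; exists x; exact/mem_set. Qed.

Lemma induced_fint_subproof (f : fsym L)
    (args : 'I_(fsym_arity f) -> set_type N) :
  fint M f (set_val \o args) \in (N : set M).
Proof. by apply/mem_set/sub_fint => i; exact: set_valP. Qed.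

Definition induced_structure : structure L :=
  @Structure L (set_type N) induced_inhabited
    (fun f args =>
       exist (fun x => x \in (N : set M)) _ (induced_fint_subproof args))
    (fun r args => rint M r (set_val \o args)).

End induced_structure.

Definition elementary (L : language) (M : structure L) (N : substructure M) :
    Prop :=
  forall (phi : form L nat) (e : nat -> set_type N),
    @sat L (induced_structure N) nat phi e <-> sat phi (set_val \o e).

(* Formulas with parameters in [A] and free variables indexed by [I]. *)
Definition pform (L : language) (M : structure L) (A : set M) (I : Type) :
    Type :=
  form L (I + set_type A).

Definition psat (L : language) (M : structure L) (A : set M) (I : Type)
    (a : I -> M) (phi : pform A I) : Prop :=
  sat phi (fun v => match v with inl i => a i | inr c => set_val c end).

(* Complete types over [A], consistent with the elementary diagram of [M]:
   finite satisfiability is tested in [M] itself. *)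
Record ctype (L : language) (M : structure L) (A : set M) (I : Type) : Type :=
  CType {
  ctype_set :> set (pform A I);
  ctype_finsat : forall F : set (pform A I), finite_set F -> F `<=` ctype_set ->
    exists a : I -> M, forall phi, F phi -> psat a phi;
  ctype_complete : forall phi : pform A I,
    ctype_set phi \/ ctype_set (fneg phi) }.

Section type_of_tuple.
Context (L : language) (M : structure L) (A : set M) (I : Type) (a : I -> M).

Lemma tp_finsat (F : set (pform A I)) : finite_set F -> F `<=` psat a ->
  exists b : I -> M, forall phi, F phi -> psat b phi.
Proof. by move=> _ Fa; exists a. Qed.

Lemma tp_complete (phi : pform A I) : psat a phi \/ psat a (fneg phi).
Proof. by have [h|h] := pselect (psat a phi); [left|right]. Qed.

Definition tp : ctype A I := CType tp_finsat tp_complete.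

End type_of_tuple.

Arguments tp {L M} A {I} a.

Section stone_space.
Context (L : language) (M : structure L) (A : set M) (I : Type).

HB.instance Definition _ := gen_eqMixin (ctype A I).
HB.instance Definition _ := gen_choiceMixin (ctype A I).

Definition stone_basic (phi : pform A I) : set (ctype A I) :=
  [set p | ctype_set p phi].

Let fand (phi psi : pform A I) : pform A I := fneg (fimp phi (fneg psi)).

(* A consequence of at most two formulas of a complete type belongs to it. *)
Lemma ctype_entails (p : ctype A I) (phi psi theta : pform A I) :
  (forall a : I -> M, psat a phi -> psat a psi -> psat a theta) ->
  ctype_set p phi -> ctype_set p psi -> ctype_set p theta.
Proof.
move=> h pphi ppsi; have [//|pn] := ctype_complete p theta.
have [||a ha] := @ctype_finsat _ _ _ _ p [set phi; psi; fneg theta].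
- by rewrite !finite_setU; do !split; exact: finite_set1.
- by move=> x [[->|->]|->].
have /(_ _)[] : psat a (fneg theta) by apply: ha; right.
by apply: h; apply: ha; left; [left|right].
Qed.

Lemma stone_basic_cover : \bigcup_(phi in setT) stone_basic phi = setT.
Proof.
apply/seteqP; split=> // p _.
by have [h|h] := ctype_complete p fbot; [exists fbot|exists (fneg fbot)].
Qed.

Lemma stone_basic_join (phi psi : pform A I) (p : ctype A I) :
  [set: pform A I] phi -> [set: pform A I] psi ->
  stone_basic phi p -> stone_basic psi p ->
  exists k, [/\ [set: pform A I] k, stone_basic k p
    & stone_basic k `<=` stone_basic phi `&` stone_basic psi].
Proof.
move=> _ _ pphi ppsi; exists (fand phi psi); split=> //.
  by apply: (ctype_entails _ pphi ppsi) => a h1 h2 h; exact: (h h1 h2).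
move=> q qh; split; apply: (ctype_entails _ qh qh) => a h _;
  by apply: contrapT => h'; apply: h => h1 h2; apply: h'.
Qed.

HB.instance Definition _ := isBaseTopological.Build (ctype A I)
  stone_basic_cover stone_basic_join.

End stone_space.

(* [run sB O x n] is the answer of B in round [n]; a strategy of B only reads
   the moves of A, since the moves of B are determined by them. *)
Section strong_choquet.
Context (Z : topologicalType).

Definition choquet_strategy : Type := seq (set Z * Z) -> set Z.

Definition choquet_answer (sB : choquet_strategy) (O : nat -> set Z)
    (x : nat -> Z) (n : nat) : set Z :=
  sB [seq (O i, x i) | i <- iota 0 n.+1].

Definition choquet_legalA (W O : nat -> set Z) (x : nat -> Z) (n : nat) : Prop :=
  [/\ open (O n), O n (x n)
    & O n `<=` (if n is m.+1 then W m else setT)].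

Definition choquet_legalB (W O : nat -> set Z) (x : nat -> Z) (n : nat) : Prop :=
  [/\ open (W n), W n (x n) & W n `<=` O n].

Definition choquet_winning (sB : choquet_strategy) : Prop :=
  forall (O : nat -> set Z) (x : nat -> Z),
    let W := choquet_answer sB O x in
    (forall n, (forall i, (i <= n)%N -> choquet_legalA W O x i) ->
       choquet_legalB W O x n) /\
    ((forall n, choquet_legalA W O x n) -> \bigcap_n W n !=set0).

Definition strong_choquet : Prop := exists sB, choquet_winning sB.

End strong_choquet.

Section monster.
Context (L : language) (kappa : Type) (M : structure L).

Definition saturated : Prop :=
  forall A : set M, small kappa A ->
    forall p : ctype A unit, exists a : unit -> M, tp A a = p.

(* Strong homogeneity: small partial elementary maps extend to
   automorphisms. *)
Definition homogeneous : Prop :=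
  forall (A : set M) (f : set_type A -> M), small kappa A ->
    (forall phi : form L (set_type A), sat phi set_val <-> sat phi f) ->
    exists2 s : M -> M, automorphism s & forall c, s (set_val c) = f c.

(* The only largeness required of [kappa]: it exceeds [aleph_0] and the number
   of symbols of the language. *)
Definition monster_model (T : set (sentence L)) : Prop :=
  [/\ small kappa [set: nat],
      small kappa [set: (fsym L + rsym L)%type],
      models M T,
      saturated
    & homogeneous].

Definition type_definable (I : Type) (A : set M) (D : set (I -> M)) : Prop :=
  exists Phi : set (pform A I),
    D = [set a | forall phi, Phi phi -> psat a phi].

Definition pseudo_closed (I : Type) (D : set (I -> M)) : Prop :=
  exists2 A : set M, small kappa A & type_definable A D.

Definition pseudo_Fsigma (I : Type) (D : set (I -> M)) : Prop :=
  exists2 F : nat -> set (I -> M),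
    (forall n, pseudo_closed (F n)) & D = \bigcup_n F n.

Section relations.
Context (I : Type).
Implicit Types (X Y K : set (I -> M)) (E : set ((I -> M) * (I -> M))).

(* Identification of pairs of [I]-tuples with [I + I]-tuples. *)
Definition as_tuples E : set (I + I -> M) :=
  [set w : I + I -> M | E (w \o inl, w \o inr)].

Definition invariant_rel E : Prop :=
  forall s : M -> M, automorphism s ->
    forall a b, E (a, b) <-> E (s \o a, s \o b).

Definition equivalence_on X E : Prop :=
  [/\ forall a, X a -> E (a, a),
      forall a b, X a -> X b -> E (a, b) -> E (b, a)
    & forall a b c, X a -> X b -> X c -> E (a, b) -> E (b, c) -> E (a, c)].

Definition classes X E : set (set (I -> M)) :=
  [set [set b | X b /\ E (a, b)] | a in X].

Definition bounded_on X E : Prop := small kappa (classes X E).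

Definition invariant_Fsigma_equivalence X E : Prop :=
  [/\ invariant_rel E, pseudo_Fsigma (as_tuples E) & equivalence_on X E].

Definition normal_form X E (U : nat -> set ((I -> M) * (I -> M))) : Prop :=
  [/\ forall n, type_definable set0 (as_tuples (U n)),
      E = \bigcup_n U n,
      forall a, X a -> U 0 (a, a),
      forall n a b, U n (a, b) -> U n (b, a)
    & forall n a b c, X a -> X b -> X c ->
        U n (a, c) -> U n (c, b) -> U n.+1 (a, b)].

Definition strongly_closed K E (U : nat -> set ((I -> M) * (I -> M))) : Prop :=
  exists n, E `&` (K `*` K) = U n `&` (K `*` K).

Definition class_union X E Y : Prop :=
  exists2 Q : set (set (I -> M)), Q `<=` classes X E & Y = \bigcup_(K in Q) K.

Definition type_space (A : set M) Y : set (ctype A I) :=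
  [set tp A a | a in Y].

Definition pseudo_strong_choquet Y : Prop :=
  forall N : substructure M, elementary N -> small kappa N ->
    strong_choquet (set_type (type_space (A := N) Y)).

Definition transitive_on (G : set (M -> M)) K : Prop :=
  forall a b, K a -> K b -> exists2 s, G s & s \o a = b.

Definition preserves_classes (G : set (M -> M)) X E : Prop :=
  forall s, G s -> forall K, classes X E K -> [set s \o a | a in K] = K.

End relations.

End monster.

(* Main.v *)
Require Import Defs.
From mathcomp Require Import all_boot all_order all_algebra.
From mathcomp Require Import all_classical all_reals all_analysis.
From Stdlib Require List.
(* [form] also names a notion of [all_algebra]. *)
Import Defs.

Set Implicit Arguments.
Unset Strict Implicit.
Unset Printing Implicit Defensive.

Local Open Scope classical_set_scope.
Local Open Scope card_scope.

(* Fix c0 in C.  Say that Z is piecewise syndetic in C if finitely many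
   Gamma-preimages of Z have a union W which is thick: any finitely many
   Gamma-preimages of W meet inside C.  Sets that are not piecewise syndetic form
   a Gamma-invariant proper ideal.

   Given Z piecewise syndetic with thick W, let Q be an ultrafilter on C
   containing all the preimages of W and no set of the ideal.  Two independent
   realizations y, y' of the limit of Q have the same type over a small set of
   representatives of the classes of E, so (y, y') is in some U_n.  Hence every
   definable D containing U_n contains (a, b) for Q-many a and, given a, for
   Q-many b.  Moving a to an arbitrary c in C by Gamma, the set of b in W with
   D(c, b) is piecewise syndetic, and so is the set of b in Z with D(s c, b) for
   one of the finitely many s defining W.  As C is unbounded for the U_n, c can be
   chosen so that all the s c are as far from c0 as desired.

   Let N be a small elementary submodel containing c0 and such tuples s c for all
   piecewise syndetic N-definable Z.  A point e of C is big if every N-definable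
   set containing e is piecewise syndetic; by saturation, each piecewise syndetic
   N-definable set contains big points arbitrarily far from c0.  So, when
   the strong Choquet game is played in the type space of Y along a binary tree,
   with big points, the open sets of distinct nodes of level n can be kept
   disjoint from U_n.  Realizations of the types obtained along distinct branches
   are then pairwise inequivalent. *)

(** * Cardinals *)

(** [Zorn_bigcup] is applied to the sets whose union with [S0] satisfies [P]; there the empty chain
    amounts to [P S0]. *)
Lemma Zorn_above (T : Type) (P : set (set T)) (S0 : set T) : P S0 ->
  (forall F : set (set T), F !=set0 -> F `<=` P -> total_on F subset ->
    P (\bigcup_(S in F) S)) ->
  exists S, [/\ P S, S0 `<=` S & forall S', P S' -> S `<=` S' -> S' = S].
Proof.
move=> P0 Pchain.
have [F FP Ftot|S [PS Smax]] := @Zorn_bigcup T [set S | P (S0 `|` S)].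
  have [->|F0] := eqVneq F set0; first by rewrite /= bigcup_set0 setU0.
  rewrite /=; have -> : S0 `|` \bigcup_(S in F) S =
      \bigcup_(S in [set S0 `|` S | S in F]) S.
    have [S FS] := (set0P _).1 F0; apply/seteqP; split=> [x [Sx|[S' FS' S'x]]|x].
    - by exists (S0 `|` S); [exists S|left].
    - by exists (S0 `|` S'); [exists S'|right].
    - by move=> [_ [S' FS' <-]] [?|?]; [left|right; exists S'].
  apply: Pchain.
  - by have [S FS] := (set0P _).1 F0; exists (S0 `|` S); exists S.
  - by move=> _ [S FS <-]; exact: FP.
  - by move=> _ _ [S FS <-] [S' FS' <-]; have [h|h] := Ftot _ _ FS FS';
      [left|right]; apply: setUS.
exists (S0 `|` S); split=> // S' PS' SS'; apply: contrapT => S'S.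
apply: (Smax S').
  split; first by move=> x Sx; apply: SS'; right.
  by move=> S'S2; apply: S'S; apply/seteqP; split=> // x /S'S2; right.
rewrite /= (_ : S0 `|` S' = S') //; apply/setUidPr => x ?.
by apply: SS'; left.
Qed.

Lemma sval_inj (T : Type) (P : T -> Prop) : injective (@sval T P).
Proof. by move=> [x Px] [y Py] /= xy; apply: eq_exist. Qed.

Definition inj_le (T U : Type) : Prop := exists f : T -> U, injective f.

Lemma inj_le_refl T : inj_le T T. Proof. by exists id. Qed.

Lemma inj_le_trans T U V : inj_le T U -> inj_le U V -> inj_le T V.
Proof. by move=> [f fi] [g gi]; exists (g \o f); exact: inj_comp. Qed.

Lemma card_le_injP (T U : Type) (A : set T) (B : set U) :
  (A #<= B) <-> inj_le (set_type A) (set_type B).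
Proof.
split=> [/card_leP/injfunPex[f _ fi]|[f fi]].
  by exists f => x y E; apply: fi E; exact: in_setT.
by apply/card_leP/injfunPex; exists f => // x y _ _; exact: fi.
Qed.

Lemma inj_le_setT T : inj_le (set_type [set: T]) T.
Proof. by exists set_val; exact: val_inj. Qed.

Lemma inj_le_Tset T : inj_le T (set_type [set: T]).
Proof. by exists (@to_setT T) => x y /(congr1 set_val). Qed.

(** Zorn on the graphs of partial injections: a maximal graph missing some [x0] on the left and some
    [y0] on the right could be enlarged by [(x0, y0)]. *)
Lemma inj_le_total (T U : Type) : inj_le T U \/ inj_le U T.
Proof.
pose P (R : set (T * U)) := forall p q, R p -> R q -> (p.1 = q.1) <-> (p.2 = q.2).
have [||R [PR _ Rmax]] := @Zorn_above _ P set0.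
- by [].
- move=> F _ FP Ftot p q [R FR Rp] [S FS Sq].
  have [RS|SR] := Ftot _ _ FR FS; first by apply: (FP _ FS) => //; exact: RS.
  by apply: (FP _ FR) => //; exact: SR.
have [Rtot|] := pselect (forall x, exists y, R (x, y)).
  by have [f fR] := choice Rtot; left; exists f => x y ?;
    apply/(PR (x, f x) (y, f y)).
move=> /existsNP[x0 x0R].
have [Rsurj|] := pselect (forall y, exists x, R (x, y)).
  by have [f fR] := choice Rsurj; right; exists f => x y ?;
    apply/(PR (f x, x) (f y, y)).
move=> /existsNP[y0 y0R]; exfalso; apply: (x0R); exists y0.
have <- : R `|` [set (x0, y0)] = R; last by right.
apply: Rmax; last by move=> p; left.
move=> [x y] [x' y'] [Rp|[-> ->]] [Rq|[-> ->]] //=.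
- exact: (PR (x, y) (x', y')).
- by split=> E; exfalso; [apply: x0R; exists y|apply: y0R; exists x];
    rewrite -E.
- by split=> E; exfalso; [apply: x0R; exists y'|apply: y0R; exists x'];
    rewrite E.
Qed.

(** * Squares of infinite types *)

Section square.
Variables (T : Type) (g : nat -> T).
Hypothesis g_inj : injective g.

(** [R] is meant as the graph of an injection of a square into its side. The side is read off the
    diagonal, and the last two conditions of [P] make the domain of [R] exactly the square of
    [dom R]. *)
Let dom (R : set (T * T * T)) : set T := [set x | exists z, R (x, x, z)].

Let P (R : set (T * T * T)) :=
  [/\ forall p q z w, R (p, z) -> R (q, w) -> (p = q) <-> (z = w),
      forall x y, dom R x -> dom R y -> exists z, R (x, y, z)
    & forall x y z, R (x, y, z) -> [/\ dom R x, dom R y & dom R z]].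

(** Zorn gives a maximal [R] above the copy of [pickle] on the range of [g]. If the complement of
    [dom R] injects into [dom R], so does [T], and the pairing pulls back to [T]. Otherwise the
    complement contains a fresh copy of [dom R], to which [R] can be extended. *)
Lemma inj_le_square : inj_le (T * T) T.
Proof.
pose R0 : set (T * T * T) :=
  [set (g ij.1, g ij.2, g (pickle ij)) | ij in [set: nat * nat]].
have R0P i j : R0 (g i, g j, g (pickle (i, j))) by exists (i, j).
have dR0 i : dom R0 (g i) by exists (g (pickle (i, i))).
have R0in x : dom R0 x -> exists i, x = g i.
  by move=> [z [[i j] _ [<- _ _]]]; exists i.
have [||R [[R1 R2 R3] R0R Rmax]] := @Zorn_above _ P R0.
- split.
  + move=> p q z w [[i j] _ [<- <-]] [[i' j'] _ [<- <-]] /=.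
    split=> [[/g_inj -> /g_inj ->]//|/g_inj/(pcan_inj pickleK)[-> ->]//].
  + by move=> x y /R0in[i ->] /R0in[j ->]; exists (g (pickle (i, j))).
  + by move=> x y z [[i j] _ [<- <- <-]]; split; exact: dR0.
- move=> F _ FP Ftot.
  have common R S : F R -> F S -> exists2 Q, F Q & R `<=` Q /\ S `<=` Q.
    by move=> FR FS; have [RS|SR] := Ftot _ _ FR FS; [exists S => //; split|exists R => //; split].
  have domS R S : R `<=` S -> dom R `<=` dom S.
    by move=> RS x [z /RS]; exists z.
  split.
  + move=> p q z w [R FR Rp] [S FS Sq].
    have [Q FQ [RQ SQ]] := common _ _ FR FS; have [Q1 _ _] := FP _ FQ.
    by apply: Q1; [exact: RQ|exact: SQ].
  + move=> x y [z [R FR Rx]] [w [S FS Sy]].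
    have [Q FQ [RQ SQ]] := common _ _ FR FS; have [_ Q2 _] := FP _ FQ.
    have [|| u Qu] := Q2 x y; last by exists u; exists Q.
      by exists z; exact: RQ.
    by exists w; exact: SQ.
  + move=> x y z [R FR Rz]; have [_ _ R3] := FP _ FR.
    by have [] := R3 _ _ _ Rz; split; apply: domS;
      try exact: (@bigcup_sup _ _ R).
have dRg i : dom R (g i) by have [z /R0R ?] := dR0 i; exists z.
have /choice[f fP] (p : T * T) :
    exists z, dom R p.1 -> dom R p.2 -> R (p, z).
  case: p => x y.
  have [[dx dy]|nd] := pselect (dom R x /\ dom R y).
    by have [z] := R2 _ _ dx dy; exists z.
  by exists x => /= dx dy; case: nd.
have fD p : dom R p.1 -> dom R p.2 -> dom R (f p).
  by case: p => x y dx dy; have /R3[] := fP (x, y) dx dy.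
have finj p q : dom R p.1 -> dom R p.2 -> dom R q.1 -> dom R q.2 ->
    f p = f q -> p = q.
  by move=> *; apply/R1; [exact: fP|exact: fP|].
have g01 : g 0 <> g 1 by move=> /g_inj.
(* The tags [g 0] and [g 1] make two disjoint copies of [dom R] inside itself: one for its own
   points, one for the others, which [h] first moves into [dom R]. *)
have codeP (D' : set T) (h : T -> T) :
    (forall x, D' x -> ~ dom R x -> dom R (h x)) ->
    (forall x y, D' x -> D' y -> ~ dom R x -> ~ dom R y -> h x = h y -> x = y) ->
    exists2 k : T -> T, forall x, D' x -> dom R (k x) &
      forall x y, D' x -> D' y -> k x = k y -> x = y.
  move=> hD hinj.
  exists (fun x => if pselect (dom R x) then f (g 0, x) else f (g 1, h x)).
    by move=> x D'x; case: pselect => dx; apply: fD => //=; exact: hD.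
  move=> x y D'x D'y.
  case: (pselect (dom R x)) => dx; case: (pselect (dom R y)) => dy /finj E.
  - by have [] : (g 0, x) = (g 0, y) by apply: E => //=; exact: dRg.
  - by have [] : (g 0, x) = (g 1, h y) by apply: E => //=; first [exact: dRg|exact: hD].
  - have [/esym/g01//] : (g 1, h x) = (g 0, y).
      by apply: E => //=; first [exact: dRg|exact: hD].
  - have [] : (g 1, h x) = (g 1, h y) by apply: E => //=; first [exact: dRg|exact: hD].
    exact: hinj.
have [[h hi]|[u ui]] := inj_le_total {x | ~ dom R x} {x | dom R x}.
  pose h' x := if pselect (dom R x) is right n
    then sval (h (exist _ x n)) else g 0.
  have [||k kD ki] := codeP setT h'.
  - by move=> x _ dx; rewrite /h'; case: pselect => // n; exact: svalP.
  - move=> x y _ _ dx dy; rewrite /h'.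
    case: pselect => // nx; case: pselect => // ny E.
    have /hi [] // : h (exist _ x nx) = h (exist _ y ny) by exact: sval_inj.
  exists (fun p => f (k p.1, k p.2)) => -[x y] [x' y'] /finj E.
  have {E} [] : (k x, k y) = (k x', k y') by apply: E; exact: kD.
  by move=> /(ki _ _ I I)-> /(ki _ _ I I)->.
exfalso.
pose v x := if pselect (dom R x) is left d then sval (u (exist _ x d)) else g 0.
have vnD x : dom R x -> ~ dom R (v x).
  by rewrite /v; case: pselect => // d _; exact: (svalP (u _)).
have vi x y : dom R x -> dom R y -> v x = v y -> x = y.
  rewrite /v; case: pselect => // dx; case: pselect => // dy _ _ E.
  by have /ui [] : u (exist _ x dx) = u (exist _ y dy) by exact: sval_inj.
pose D' : set T := dom R `|` v @` dom R.
have /choice[h hP] x : exists y, (v @` dom R) x -> dom R y /\ v y = x.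
  have [[y dy <-]|n] := pselect ((v @` dom R) x); first by exists y.
  by exists x.
have [||k kD ki] := codeP D' h.
- by move=> x [//|/hP[]].
- move=> x y [//|/hP[_ Ex]] [//|/hP[_ Ey]] _ _ E; by rewrite -Ex E.
(* A pair of [D'] outside the square of [dom R] is compressed into that square by [k], coded by [f]
   and sent by [v] to the fresh copy, so that no old value is reused. *)
pose nd x y := D' x /\ D' y /\ ~ (dom R x /\ dom R y).
pose R' := R `|` [set p | nd p.1.1 p.1.2 /\ p.2 = v (f (k p.1.1, k p.1.2))].
have dR' : dom R' = D'.
  apply/seteqP; split=> x.
    by move=> [z [Rz|[[Dx _] _]]] //; left; exists z.
  move=> D'x; have [[z Rz]|ndx] := pselect (dom R x); first by exists z; left.
  by exists (v (f (k x, k x))); right; split=> //; split=> //; split=> // -[].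
have : R' = R.
  apply: Rmax; last by move=> p; left.
  split.
  - move=> [x y] [x' y'] z w.
    move=> [Rz|/= [[Dx [Dy n1]] ->]] [Rw|/= [[Dx' [Dy' n2]] ->]].
    + exact: R1.
    + have [dx dy dz] := R3 _ _ _ Rz.
      split=> [[E1 E2]|E]; first by case: n2; rewrite -E1 -E2.
      by case: (vnD (f (k x', k y'))); [apply: fD; exact: kD|rewrite -E].
    + have [dx dy dz] := R3 _ _ _ Rw.
      split=> [[E1 E2]|E]; first by case: n1; rewrite E1 E2.
      by case: (vnD (f (k x, k y))); [apply: fD; exact: kD|rewrite E].
    + split=> [[-> ->]//|/vi E].
      have [] : (k x, k y) = (k x', k y').
        by apply: finj; try exact: kD; apply: E; apply: fD; exact: kD.
      by move=> /(ki _ _ Dx Dx')-> /(ki _ _ Dy Dy')->.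
  - rewrite dR' => x y Dx Dy.
    have [[dx dy]|n] := pselect (dom R x /\ dom R y).
      by have [z] := R2 _ _ dx dy; exists z; left.
    by exists (v (f (k x, k y))); right.
  - rewrite dR' => x y z [/R3[dx dy dz]|/= [[Dx [Dy _]] ->]].
      by split; left.
    split=> //; right; exists (f (k x, k y)) => //.
    by apply: fD; exact: kD.
move=> R'R; apply: (vnD (g 0)) => //.
have : dom R' (v (g 0)) by rewrite dR'; right; exists (g 0).
by rewrite R'R.
Qed.

End square.

Lemma inj_le_prod T U T' U' : inj_le T T' -> inj_le U U' ->
  inj_le (T * U) (T' * U').
Proof.
move=> [f fi] [g gi]; exists (fun p => (f p.1, g p.2)).
by move=> [x y] [x' y'] [/fi-> /gi->].
Qed.

(** The length is stored beside the folded code, since the end marker [g 0] may itself be the code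
    of a pair. *)
Lemma inj_le_seq T : inj_le nat T -> inj_le (seq T) T.
Proof.
move=> [g gi]; have [f fi] := inj_le_square gi.
exists (fun s => f (g (size s), foldr (fun x y => f (x, y)) (g 0) s)).
move=> s t /fi[/gi]; elim: s t => [[]//|x s IH [//|y t]] /= [E] /fi[->].
by move=> /(IH _ E)->.
Qed.

Lemma inj_le_seq2 T U : inj_le T U -> inj_le (seq T) (seq U).
Proof. by move=> [f fi]; exists (map f); exact: inj_map. Qed.

(** * Formulas *)

Definition smallT (kappa T : Type) : Prop := inj_le T kappa /\ ~ inj_le kappa T.

Definition to_set (T : Type) (A : set T) (x : T) (Ax : A x) : set_type A :=
  exist (fun x => x \in A) x (mem_set Ax).

Lemma set_val_inj (T : Type) (A : set T) : injective (@set_val T A).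
Proof. by move=> x y xy; apply: val_inj. Qed.

Lemma smallP (kappa T : Type) (A : set T) :
  small kappa A <-> smallT kappa (set_type A).
Proof.
rewrite /small /card_lt; split.
  move=> /andP[/card_le_injP AK /negP KA]; split.
    exact: inj_le_trans AK (inj_le_setT _).
  move=> h; apply: KA; apply/card_le_injP.
  exact: inj_le_trans (inj_le_setT _) h.
move=> [AK KA]; apply/andP; split.
  by apply/card_le_injP; exact: inj_le_trans AK (inj_le_Tset _).
apply/negP => /card_le_injP h; apply: KA.
exact: inj_le_trans (inj_le_Tset _) h.
Qed.

Lemma smallT_le kappa T U : inj_le T U -> smallT kappa U -> smallT kappa T.
Proof.
move=> TU [UK KU]; split; first exact: inj_le_trans TU UK.
by move=> KT; apply: KU; exact: inj_le_trans KT TU.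
Qed.

Lemma smallTP (kappa T : Type) : small kappa [set: T] <-> smallT kappa T.
Proof.
rewrite smallP; split; apply: smallT_le; first exact: inj_le_Tset.
exact: inj_le_setT.
Qed.

Lemma small_sub kappa T (A B : set T) : A `<=` B -> small kappa B -> small kappa A.
Proof.
move=> AB; rewrite !smallP; apply: smallT_le.
exists (fun x : set_type A => to_set (AB _ (set_valP x))).
by move=> x y /(congr1 set_val) h; exact: set_val_inj.
Qed.

Lemma small_image kappa T U (f : T -> U) (A : set T) :
  small kappa A -> small kappa (f @` A).
Proof.
rewrite !smallP; apply: smallT_le; apply/card_le_injP; exact: card_image_le.
Qed.

Lemma small_range kappa T U (f : T -> U) : smallT kappa T -> small kappa (range f).
Proof. by move=> /smallTP; exact: small_image. Qed.

(** * Cardinal arithmetic below [kappa] *)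

Section small_closure.
Variable kappa : Type.
Hypothesis kappa_nat : smallT kappa nat.

(** The larger of the two types is replaced by [nat] if it injects into [nat]; the bound is then
    infinite and absorbs its square. *)
Lemma smallT_bound T U : smallT kappa T -> smallT kappa U ->
  exists V, [/\ smallT kappa V, inj_le T V, inj_le U V & inj_le nat V].
Proof.
move=> sT sU.
have [W [sW TW UW]] : exists W, [/\ smallT kappa W, inj_le T W & inj_le U W].
  by have [?|?] := inj_le_total T U; [exists U|exists T]; split=> //;
    exact: inj_le_refl.
have [nW|Wn] := inj_le_total nat W; first by exists W.
exists nat; split=> //; [exact: inj_le_trans TW Wn|exact: inj_le_trans UW Wn|].
exact: inj_le_refl.
Qed.

Lemma smallT_prod T U : smallT kappa T -> smallT kappa U -> smallT kappa (T * U).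
Proof.
move=> sT sU; have [V [sV TV UV [g gi]]] := smallT_bound sT sU.
apply: smallT_le sV; apply: inj_le_trans (inj_le_square gi).
exact: inj_le_prod.
Qed.

Lemma smallT_sum T U : smallT kappa T -> smallT kappa U -> smallT kappa (T + U).
Proof.
move=> sT sU; have [V [sV [f fi] [h hi] [g gi]]] := smallT_bound sT sU.
apply: smallT_le (smallT_prod kappa_nat sV).
exists (fun s => match s with inl x => (0, f x) | inr y => (1, h y) end).
by move=> [x|x] [y|y] [] // => [/fi->|/hi->].
Qed.

Lemma smallT_seq T : smallT kappa T -> smallT kappa (seq T).
Proof.
move=> sT; have [V [sV TV _ nV]] := smallT_bound sT sT.
apply: smallT_le sV; exact: inj_le_trans (inj_le_seq2 TV) (inj_le_seq nV).
Qed.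

Lemma smallT_countable (T : countType) : smallT kappa T.
Proof.
by apply: smallT_le kappa_nat; exists pickle; exact: pcan_inj pickleK.
Qed.

Lemma smallT_tree T : smallT kappa T -> smallT kappa (GenTree.tree T).
Proof.
move=> sT; apply: smallT_le (smallT_seq (smallT_sum kappa_nat sT)).
exists (@GenTree.encode T); exact: pcan_inj (@GenTree.codeK T).
Qed.

End small_closure.

Lemma In_flatten (I : finType) (T : Type) (s : I -> seq T) (i : I) (x : T) :
  List.In x (s i) -> List.In x (flatten [seq s i | i <- enum I]).
Proof.
move=> xi; have : i \in enum I by rewrite mem_enum.
elim: (enum I) => //= j l IH; rewrite inE => /predU1P[<-|/IH h]; apply/List.in_app_iff.
  by left.
by right.
Qed.

Section formulas.
Variable L : language.

Fixpoint tren (V W : Type) (g : V -> W) (t : term L V) : term L W :=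
  match t with
  | tvar v => tvar (g v)
  | tfun f args => tfun f (fun i => tren g (args i))
  end.

Fixpoint fren (V W : Type) (g : V -> W) (phi : form L V) : form L W :=
  match phi with
  | fbot => fbot
  | feq t u => feq (tren g t) (tren g u)
  | frel r args => frel r (fun i => tren g (args i))
  | fimp phi1 phi2 => fimp (fren g phi1) (fren g phi2)
  | fall phi1 => fall (fren (omap g) phi1)
  end.

Fixpoint tvars (V : Type) (t : term L V) : seq V :=
  match t with
  | tvar v => [:: v]
  | tfun f args => flatten [seq tvars (args i) | i <- enum 'I_(fsym_arity f)]
  end.

Fixpoint fvars (V : Type) (phi : form L V) : seq V :=
  match phi with
  | fbot => [::]
  | feq t u => tvars t ++ tvars u
  | frel r args => flatten [seq tvars (args i) | i <- enum 'I_(rsym_arity r)]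
  | fimp phi1 phi2 => fvars phi1 ++ fvars phi2
  | fall phi1 => pmap id (fvars phi1)
  end.

Definition fand V (phi psi : form L V) : form L V := fneg (fimp phi (fneg psi)).
Definition fex V (phi : form L (option V)) : form L V := fneg (fall (fneg phi)).

Section semantics.
Variable M : structure L.

Lemma teval_ren V W (g : V -> W) (t : term L V) (e : W -> M) :
  teval e (tren g t) = teval (e \o g) t.
Proof. by elim: t => //= f args IH; congr fint; apply/funext. Qed.

Lemma sat_ren V (phi : form L V) :
  forall W (g : V -> W) (e : W -> M), sat (fren g phi) e <-> sat phi (e \o g).
Proof.
elim: phi => {V} [V|V t u|V r args|V phi IH1 psi IH2|V phi IH] W g e //=.
- by rewrite !teval_ren.
- by under eq_fun do rewrite teval_ren.
- by rewrite IH1 IH2.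
- split=> h x; have := h x; rewrite IH; congr (sat _ _); apply/funext;
    by case.
Qed.

Lemma teval_ext V (t : term L V) (e e' : V -> M) :
  (forall v, List.In v (tvars t) -> e v = e' v) -> teval e t = teval e' t.
Proof.
elim: t => /= [v h|f args IH h]; first by apply: h; left.
congr fint; apply/funext => i; apply: IH => v vi; apply: h.
exact: (@In_flatten _ _ (fun i => tvars (args i)) i).
Qed.

Lemma sat_ext V (phi : form L V) (e e' : V -> M) :
  (forall v, List.In v (fvars phi) -> e v = e' v) -> sat phi e <-> sat phi e'.
Proof.
elim: phi e e' => {V} [V|V t u|V r args|V phi IH1 psi IH2|V phi IH] e e' //= h.
- rewrite (@teval_ext _ t e e') ?(@teval_ext _ u e e') // => v vi;
    apply: h; apply/List.in_app_iff; by [right|left].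
- rewrite (_ : (fun i => teval e (args i)) = (fun i => teval e' (args i))) //.
  apply/funext => i; apply: teval_ext => v vi; apply: h.
  exact: (@In_flatten _ _ (fun i => tvars (args i)) i).
- by rewrite (IH1 e e') ?(IH2 e e') // => v vi; apply: h;
    apply/List.in_app_iff; by [right|left].
- suff E x : sat phi (oapp e x) <-> sat phi (oapp e' x) by split=> s x; apply/E.
  apply: IH => -[v|] vi //=; apply: h.
  elim: (fvars phi) vi => // o l IHl [->|/IHl lv]; first by left.
  by case: o => [w|] //; right.
Qed.

Lemma sat_ext_imp V (phi : form L V) (e e' : V -> M) :
  (forall v, List.In v (fvars phi) -> e v = e' v) -> sat phi e -> sat phi e'.
Proof. by move=> /sat_ext->. Qed.

Lemma sat_and V (phi psi : form L V) (e : V -> M) :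
  sat (fand phi psi) e <-> sat phi e /\ sat psi e.
Proof.
rewrite /=; split=> [h|[h1 h2] h]; last exact: (h h1 h2).
by split; apply: contrapT => h'; apply: h => h1 h2; apply: h'.
Qed.

Lemma sat_ex V (phi : form L (option V)) (e : V -> M) :
  sat (fex phi) e <-> exists x, sat phi (oapp e x).
Proof.
rewrite /=; split=> [h|[x h] h']; last exact: (h' x h).
by apply: contrapT => h'; apply: h => x sx; apply: h'; exists x.
Qed.

Lemma teval_aut V (s : M -> M) (t : term L V) (e : V -> M) :
  automorphism s -> teval (s \o e) t = s (teval e t).
Proof.
move=> [_ sf _]; elim: t => //= f args IH; rewrite sf; congr fint.
exact/funext.
Qed.

Lemma sat_aut V (s : M -> M) (phi : form L V) : automorphism s ->
  forall e : V -> M, sat phi (s \o e) <-> sat phi e.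
Proof.
move=> sa; have [[s' s'K sK'] _ sr] := sa; have si := can_inj s'K.
elim: phi => {V} [V|V t u|V r args|V phi IH1 psi IH2|V phi IH] e //=.
- by rewrite !teval_aut //; split=> [/si|->].
- rewrite (sr r (fun i => teval e (args i))).
  rewrite (_ : (fun i => _) = s \o (fun i => teval e (args i))) //.
  by apply/funext => i; rewrite teval_aut.
- by rewrite IH1 IH2.
- have E x : oapp (s \o e) (s x) = s \o oapp e x by apply/funext; case.
  split=> h x; first by rewrite -IH -E.
  by rewrite -(sK' x) E IH.
Qed.

End semantics.

(** Only finitely many parameters occur in a formula, so they can be replaced by positions in a
    list. The variable type of [psi] does not depend on [V], so sets definable over a set still to
    be constructed can be indexed in advance. *)
Lemma form_params (I V : Type) (phi : form L (I + V)) :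
  exists (psi : form L (I + nat)) (l : seq V),
  forall (M : structure L) (a : I -> M) (e : V -> M) (d : M),
    sat phi (fun v => match v with inl i => a i | inr c => e c end) <->
    sat psi (fun v => match v with inl i => a i | inr k => nth d (map e l) k end).
Proof.
pose l := pmap (fun v : I + V => if v is inr c then Some c else None) (fvars phi).
have /choice[r rP] (v : V) : exists k, List.In v l ->
    forall (M : structure L) (e : V -> M) d, nth d (map e l) k = e v.
  have [vl|?] := pselect (List.In v l); last by exists 0.
  suff [k kP] : exists k, forall (M : structure L) (e : V -> M) d,
    nth d (map e l) k = e v by exists k.
  elim: l vl => //= w l IH [->|/IH[k kP]]; first by exists 0.
  by exists k.+1.
exists (fren (fun v => match v with inl i => inl i | inr c => inr (r c) end) phi).
exists l => M a e d; rewrite sat_ren; apply: sat_ext => -[//|c] cphi /=.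
rewrite rP // /l.
elim: (fvars phi) cphi => // v s IH [->|/IH sc]; first by left.
by case: v => [i|c'] //; right.
Qed.

(** * Counting formulas *)

Section small_formulas.
Variable kappa : Type.
Hypothesis kappa_nat : smallT kappa nat.
Hypothesis kappa_L : smallT kappa (fsym L + rsym L).

Fixpoint tcode (V K : Type) (g : V -> K) (t : term L V) :
    GenTree.tree (K + (fsym L + rsym L)) :=
  match t with
  | tvar v => GenTree.Leaf (inl (g v))
  | tfun f args => GenTree.Node 0 (GenTree.Leaf (inr (inl f)) ::
      [seq tcode g (args i) | i <- enum 'I_(fsym_arity f)])
  end.

(** The variable type grows under each quantifier, but all codes must lie in one type. Variables are
    therefore named in the fixed type [nat + W], the bound ones by de Bruijn indices. *)
Let bump (W V : Type) (g : V -> nat + W) (o : option V) : nat + W :=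
  if o is Some v then
    match g v with inl k => inl k.+1 | inr w => inr w end
  else inl 0.

Let bump_inj (W V : Type) (g : V -> nat + W) : injective g -> injective (bump g).
Proof.
move=> gi [v|] [w|] //=; last first.
- by case: (g w).
- by case: (g v).
- by move=> h; congr Some; apply: gi; case: (g v) (g w) h => [?|?] [?|?] // [->].
Qed.

Fixpoint fcode (W V : Type) (g : V -> nat + W) (phi : form L V) :
    GenTree.tree ((nat + W) + (fsym L + rsym L)) :=
  match phi with
  | fbot => GenTree.Node 0 [::]
  | feq t u => GenTree.Node 1 [:: tcode g t; tcode g u]
  | frel r args => GenTree.Node 2 (GenTree.Leaf (inr (inr r)) ::
      [seq tcode g (args i) | i <- enum 'I_(rsym_arity r)])
  | fimp phi1 phi2 => GenTree.Node 3 [:: fcode g phi1; fcode g phi2]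
  | fall phi1 => GenTree.Node 4 [:: fcode (bump g) phi1]
  end.

Let map_enum_inj (n : nat) (T : Type) (s t : 'I_n -> T) :
  [seq s i | i <- enum 'I_n] = [seq t i | i <- enum 'I_n] -> s =1 t.
Proof.
move=> h i; have : i \in enum 'I_n by rewrite mem_enum.
by elim: (enum 'I_n) h => //= j l IH [st /IH h]; rewrite inE => /predU1P[->|].
Qed.

Lemma tcode_inj V K (g : V -> K) : injective g -> injective (tcode g).
Proof.
move=> gi; elim=> [v|f args IH] [w|f' args'] //=; first by move=> [/gi->].
move=> [ff']; case: f' / ff' args' => args' /map_enum_inj h.
by congr tfun; apply/funext => i; exact: IH.
Qed.

Lemma fcode_inj W V (g : V -> nat + W) : injective g -> injective (fcode g).
Proof.
move=> gi phi; move: gi.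
elim: phi => {V} [V|V t u|V r args|V phi IH1 psi IH2|V phi IH] in g *;
  move=> gi [|t' u'|r' args'|phi' psi'|phi'] //=.
- by move=> [/tcode_inj-> // /tcode_inj->].
- move=> [rr']; case: r' / rr' args' => args' /map_enum_inj h.
  by congr frel; apply/funext => i; apply: (tcode_inj gi).
- by move=> [/IH1-> // /IH2->].
- by move=> [/IH-> //]; exact: bump_inj.
Qed.

Lemma smallT_form V : smallT kappa V -> smallT kappa (form L V).
Proof.
move=> sV; pose g (v : V) : nat + V := inr v.
have gi : injective g by move=> v w [].
apply: (@smallT_le _ _ (GenTree.tree ((nat + V) + (fsym L + rsym L)))).
  by exists (fcode g); exact: fcode_inj.
by apply: smallT_tree => //; do 2!apply: smallT_sum => //.
Qed.

End small_formulas.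

End formulas.

(** * Saturation *)

Lemma ultra_setC T (F : set_system T) (A : set T) : UltraFilter F ->
  F (~` A) <-> ~ F A.
Proof.
move=> FU; split=> [FnA FA|nFA]; last first.
  by have [] := in_ultra_setVsetC A FU.
have : F set0 by rewrite -(setICr A); exact: filterI.
exact: filter_not_empty.
Qed.

Lemma proper_ultra T (F : set_system T) : ProperFilter F ->
  (forall A, F A \/ F (~` A)) -> UltraFilter F.
Proof.
move=> FF Fdec; split=> // G GF FG; apply/seteqP; split=> // A GA.
have [//|/FG GnA] := Fdec A.
have : G set0 by rewrite -(setICr A); exact: filterI.
by move/filter_not_empty.
Qed.

(** The tensor product of ultrafilters. Limits along it give two independent realizations. *)
Lemma ultra_prod T U (F : set_system T) (G : set_system U) :
  UltraFilter F -> UltraFilter G ->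
  UltraFilter [set S : set (T * U) | F [set x | G [set y | S (x, y)]]].
Proof.
move=> FU GU.
suff PF : ProperFilter [set S : set (T * U) | F [set x | G [set y | S (x, y)]]].
  apply: proper_ultra => A.
  have [h|h] := in_ultra_setVsetC [set x | G [set y | A (x, y)]] FU.
    by left.
  right; apply: filterS h => x /= nG.
  by have [/nG|] := in_ultra_setVsetC [set y | A (x, y)] GU.
split; first by hnf => /= /filter_ex[x /= /filter_ex[y]].
split=> /=.
  - by apply: (@filterS _ F) filterT => x _ /=; exact: filterT.
- move=> P Q FP FQ; apply: (@filterS _ F) (filterI (FP : F _) (FQ : F _)).
  by move=> x [GP GQ] /=; exact: filterI.
- move=> P Q PQ; apply: (@filterS _ F) => x /=.
  by apply: (@filterS _ G) => y; exact: PQ.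
Qed.

Lemma ultra_above T (B : set (set T)) :
  (forall l : seq (set T), (forall S, List.In S l -> B S) ->
    exists x, forall S, List.In S l -> S x) ->
  exists2 F, UltraFilter F & B `<=` F.
Proof.
move=> Bfip.
pose G : set_system T := [set S | exists2 l : seq (set T),
  (forall S', List.In S' l -> B S') &
  forall x, (forall S', List.In S' l -> S' x) -> S x].
have [|F [FU GF]] := @ultraFilterLemma _ G; last first.
  exists F => // S BS; apply: GF; exists [:: S] => [S' [<-|//]//|x].
  by apply; left.
split; first by move=> [l /Bfip[x xl] /(_ x xl)].
split.
- by exists [::].
- move=> P Q [l lB lP] [l' lB' lQ]; exists (l ++ l').
    by move=> S /List.in_app_iff[/lB|/lB'].
  move=> x xS; split; [apply: lP|apply: lQ] => S Sl; apply: xS;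
    by apply/List.in_app_iff; auto.
- by move=> P Q PQ [l lB lP]; exists l => // x /lP/PQ.
Qed.

Section fvars_lemmas.
Variable L : language.

Lemma In_map_enum (n : nat) (T : Type) (s : 'I_n -> seq T) (x : T) :
  List.In x (flatten [seq s i | i <- enum 'I_n]) -> exists i, List.In x (s i).
Proof.
elim: (enum 'I_n) => //= i l IH /List.in_app_iff[xi|/IH//]; by exists i.
Qed.

Lemma tvars_ren V W (g : V -> W) (t : term L V) w :
  List.In w (tvars (tren g t)) -> exists2 v, List.In v (tvars t) & g v = w.
Proof.
elim: t => [v /= [<-|//]|f args IH /=]; first by exists v => //; left.
move=> h; have [i wi] := In_map_enum h; have [v vi <-] := IH i wi; exists v => //.
exact: (@In_flatten _ _ (fun i => tvars (args i)) i).
Qed.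

Lemma In_pmap_id (V : Type) (s : seq (option V)) v :
  List.In v (pmap id s) <-> List.In (Some v) s.
Proof.
elim: s => //= -[w|] s IH /=; rewrite IH; last by split=> [|[]//]; right.
by split=> [[->|]|[[->]|]]; auto.
Qed.

Lemma fvars_ren V (phi : form L V) : forall W (g : V -> W) w,
  List.In w (fvars (fren g phi)) -> exists2 v, List.In v (fvars phi) & g v = w.
Proof.
elim: phi => {V} [V|V t u|V r args|V phi IH1 psi IH2|V phi IH] W g w //=.
- by move=> /List.in_app_iff[] wt; have [v vt <-] := tvars_ren wt;
    exists v => //; apply/List.in_app_iff; auto.
- move=> h; have [i wi] := In_map_enum h; have [v vi <-] := tvars_ren wi.
  exists v => //.
  exact: (@In_flatten _ _ (fun i => tvars (args i)) i).
- by move=> /List.in_app_iff[h|h];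
    [have [v vt <-] := IH1 _ _ _ h|have [v vt <-] := IH2 _ _ _ h];
    exists v => //; apply/List.in_app_iff; auto.
- move=> /In_pmap_id h; have [[v|] //= vp [<-]] := IH _ _ _ h.
  by exists v => //; exact/In_pmap_id.
Qed.

End fvars_lemmas.

(** * Limits of tuples along ultrafilters *)

Section limits.
Variables (L : language) (kappa : Type) (M : structure L).
Hypothesis M_sat : saturated kappa M.
Hypothesis M_hom : homogeneous kappa M.

(** The formulas over [A] true at [G]-almost every point form a complete type, which saturation
    realizes. *)
Lemma filter_satisfiable (A : set M) (G : set_system M) : UltraFilter G ->
  small kappa A ->
  exists x : M, forall phi : pform A unit,
    G [set y | psat (fun=> y) phi] -> psat (fun=> x) phi.
Proof.
move=> GU sA.
pose p := [set phi : pform A unit | G [set y | psat (fun=> y) phi]].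
have p_finsat (F : set (pform A unit)) : finite_set F -> F `<=` p ->
    exists a : unit -> M, forall phi, F phi -> psat a phi.
  move=> /(@finite_seqP (form L _))[s ->] sp.
  suff : G [set y | forall phi, phi \in s -> psat (fun=> y) phi].
    by move=> /filter_ex[y ys]; exists (fun=> y).
  elim: s sp => [|phi s IH] sp.
    by apply: filterS filterT => y _ phi; rewrite in_nil.
  have Gphi : p phi by apply: sp; rewrite /= mem_head.
  have Gs : G [set y | forall phi, phi \in s -> psat (fun=> y) phi].
    by apply: IH => psi ps; apply: sp; rewrite /= inE ps orbT.
  by apply: filterS (filterI Gphi Gs) => y [yphi ys] psi;
    rewrite inE => /predU1P[->//|/ys].
have p_complete (phi : pform A unit) : p phi \/ p (fneg phi).
  exact: in_ultra_setVsetC.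
have [a tpa] := M_sat sA (CType p_finsat p_complete).
have psatE : psat a = p by move: (congr1 (@ctype_set _ _ _ _) tpa).
exists (a tt) => phi Gphi; have : psat a phi by rewrite psatE.
by congr (sat _ _); apply/funext => -[[]|].
Qed.

(** [saturated] speaks of single elements. The tuple comes from Zorn, applied to the partial
    assignments [R] satisfying every formula in their variables that holds for [F]-almost all
    [t]. *)
Lemma limit_tuple (V T : Type) (F : set_system T) (b : T -> V -> M) :
  smallT kappa V -> UltraFilter F ->
  exists a : V -> M, forall phi : form L V,
    F [set t | sat phi (b t)] -> sat phi a.
Proof.
move=> sV FU.
pose on (R : set (V * M)) (l : seq V) (a : V -> M) :=
  forall v, List.In v l -> R (v, a v).
pose P (R : set (V * M)) :=
  (forall v x y, R (v, x) -> R (v, y) -> x = y) /\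
  forall (phi : form L V) a, on R (fvars phi) a ->
    F [set t | sat phi (b t)] -> sat phi a.
have [||R [[Rfun RP] _ Rmax]] := @Zorn_above _ P set0.
- split=> // phi a phi0 /filter_ex[t /=]; by apply: sat_ext_imp => v /phi0.
- move=> C [R0 CR0] CP Ctot; split.
    move=> v x y [R CR Rx] [S CS Sy].
    have [RS|SR] := Ctot _ _ CR CS; first by apply: (CP _ CS).1 Sy; exact: RS.
    by apply: (CP _ CR).1 Rx _; exact: SR.
  move=> phi a phia.
  suff [R CR Ra] : exists2 R, C R & on R (fvars phi) a by apply: (CP _ CR).2.
  elim: (fvars phi) phia => [|v l IH] la; first by exists R0.
  have [R CR Ra] : exists2 R, C R & on R l a by apply: IH => w ?; apply: la; right.
  have [S CS Sv] := la v (or_introl erefl).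
  have [RS|SR] := Ctot _ _ CR CS.
    by exists S => // w [<-//|/Ra/RS].
  by exists R => // w [<-|/Ra//]; exact: SR.
suff Rtot v : exists x, R (v, x).
  have [a Ra] := choice Rtot; exists a => phi; apply: RP => v _; exact: Ra.
apply: contrapT => Rv.
pose dom w := exists x, R (w, x).
have [x0] := carrier_inhabited M.
have /choice[a0 a0P] w : exists x, dom w -> R (w, x).
  by have [[x ?]|?] := pselect (dom w); [exists x|exists x0].
pose upd x w := if pselect (w = v) then x else a0 w.
pose Phi := [set phi : form L V |
  (forall w, List.In w (fvars phi) -> w = v \/ dom w) /\
  F [set t | sat phi (b t)]].
pose Sx phi := [set x | sat phi (upd x)].
have Phi_and phi psi : Phi phi -> Phi psi -> Phi (fand phi psi).
  move=> [h1 F1] [h2 F2]; split.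
    by move=> w /= /List.in_app_iff[|//] /List.in_app_iff[/h1//|]
      /List.in_app_iff[/h2//|].
  by apply: filterS (filterI F1 F2) => t h /=; apply/sat_and.
(* Quantifying [v] out leaves a formula in the variables of [R], which [RP] makes true. So the sets
   [Sx phi] are nonempty, and they generate a proper filter on [M]. *)
have Phi_ex phi : Phi phi -> Sx phi !=set0.
  move=> [h1 F1].
  pose g w := if pselect (w = v) then None else Some w.
  have : sat (fex (fren g phi)) a0.
    apply: RP => [w /= /List.in_app_iff[|//] /In_pmap_id/List.in_app_iff[|//]|].
      move=> h; have [u uphi] := fvars_ren h; rewrite /g; case: pselect => // uv [<-].
      by have [//|/a0P] := h1 _ uphi.
    apply: filterS F1 => t h /=; apply/sat_ex; exists (b t v); apply/sat_ren.
    by apply: sat_ext_imp h => w _; rewrite /g /=; case: pselect => //= ->.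
  move=> /sat_ex[x /sat_ren h]; exists x.
  by apply: sat_ext_imp h => w _; rewrite /g /upd /=; case: pselect.
have [|G [GU SG]] := @ultraFilterLemma _ [set S | exists2 phi, Phi phi & Sx phi `<=` S].
  split; first by move=> [phi /Phi_ex[x xp] /(_ _ xp)].
  split.
  - exists (fneg fbot) => //; split=> //; apply: filterS filterT => t _ //.
  - move=> S S' [phi Pphi phiS] [psi Ppsi psiS]; exists (fand phi psi).
      exact: Phi_and.
    by move=> x /sat_and[/phiS ? /psiS].
  - by move=> S S' SS' [phi Pphi phiS]; exists phi => // x /phiS/SS'.
pose A := a0 @` dom.
have sA : small kappa A.
  by apply: small_sub (small_range a0 sV) => _ [w _ <-]; exists w.
have [x xP] := filter_satisfiable GU sA.
have x_sat phi : Phi phi -> sat phi (upd x).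
  move=> Pphi.
  (* [h] makes [v] the variable of a 1-type and every other assigned variable a parameter in [A].
     Unassigned variables other than [v] do not occur in [phi], and get the dummy image [inl tt]. *)
  have /choice[h hP] w : exists u : unit + set_type A,
      (w = v -> u = inl tt) /\
      (w <> v -> dom w -> exists2 c : set_type A, u = inr c & set_val c = a0 w).
    have [->|wv] := pselect (w = v); first by exists (inl tt).
    have [dw|?] := pselect (dom w); last by exists (inl tt).
    have Aw : A (a0 w) by exists w.
    by exists (inr (to_set Aw)); split=> // _ _; exists (to_set Aw).
  have E y : psat (fun=> y) (fren h phi : pform A unit) <-> sat phi (upd y).
    rewrite /psat sat_ren; apply: sat_ext => w /Pphi.1 wd; rewrite /upd /=.
    case: pselect => [/(hP w).1->//|wv]; case: wd => [//|dw].
    by have [c -> ->] := (hP w).2 wv dw.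
  apply/E/xP; apply: SG; exists phi => // y; exact: (E y).2.
have : R `|` [set (v, x)] = R.
  apply: Rmax; last by move=> p; left.
  split.
    move=> w y z [Ry|[E1 E2]] [Rz|[E3 E4]].
    - exact: Rfun Ry Rz.
    - by case: Rv; exists y; rewrite -E3.
    - by case: Rv; exists z; rewrite -E1.
    - by rewrite E2 E4.
  move=> phi a aphi Fphi; have Pphi : Phi phi.
    split=> // w /aphi[h|[-> _]]; last by left.
    by right; exists (a w).
  apply: sat_ext_imp (x_sat _ Pphi) => w /aphi; rewrite /upd; case: pselect.
    by move=> /= -> [h|[->//]]; case: Rv; exists (a v).
  by move=> /= wv [h|[/wv//]]; apply: (Rfun w _ _ _ h); apply: a0P; exists (a w).
by move=> E; apply: Rv; exists x; rewrite -E; right.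
Qed.

Hypothesis kappa_nat : smallT kappa nat.

(** The parameters are adjoined to each tuple as constant coordinates. Their limit has the same type
    as the parameters themselves, so homogeneity provides an automorphism moving it back onto
    them. *)
Lemma limit_over (I T : Type) (P : set M) (F : set_system T) (b : T -> I -> M) :
  smallT kappa I -> small kappa P -> UltraFilter F ->
  exists e : I -> M, forall phi : pform P I,
    F [set t | psat (b t) phi] -> psat e phi.
Proof.
move=> sI /smallP sP FU.
pose c t (v : I + set_type P) := match v with inl i => b t i | inr c => set_val c end.
have [a aP] := limit_tuple c (smallT_sum kappa_nat sI sP) FU.
have aP' phi : sat phi a -> F [set t | sat phi (c t)].
  move=> ha; have [//|h] := in_ultra_setVsetC [set t | sat phi (c t)] FU.
  by have /(_ ha) : sat (fneg phi) a by apply: aP.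
pose A := range (a \o inr).
have /choice[g gP] (x : set_type A) : exists p, a (inr p) = set_val x.
  by have [p _ E] := set_valP x; exists p.
have cE t : c t \o inr \o g = set_val \o g by [].
have [||s sa sE] := M_hom (A := A) (f := set_val \o g).
- exact/small_range.
- have aE : set_val = a \o (inr \o g) by apply/funext => x; rewrite /= gP.
  move=> phi; rewrite aE -sat_ren; split=> [/aP'/filter_ex[t]|h].
    by move/sat_ren.
  by apply: aP; apply: filterS filterT => t _; apply/sat_ren.
(* For the element [a (inr p)], [g] may select an index other than [p]. The equality of the two
   coordinates holds in the limit, hence already at some [c t], where it says that the parameters
   are equal. *)
have sK p : s (a (inr p)) = set_val p.
  have Ap : A (a (inr p)) by exists p.
  have := sE (to_set Ap); rewrite /= => ->.
  have : sat (feq (tvar (inr (g (to_set Ap)))) (tvar (inr p))) a by rewrite /= gP.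
  by move=> /aP'/filter_ex[t].
exists (s \o a \o inl) => phi Fphi.
have : sat phi (s \o a) by apply/sat_aut => //; exact: aP.
by rewrite /psat; congr (sat _ _); apply/funext => -[//|p] /=.
Qed.

Definition definable (I : Type) (P : set M) (D : set (I -> M)) : Prop :=
  exists phi : pform P I, D = [set a | psat a phi].

Lemma definableT I (P : set M) : definable P [set: I -> M].
Proof. by exists (fneg fbot); apply/seteqP; split=> // a _ //. Qed.

Lemma definableC I (P : set M) (D : set (I -> M)) :
  definable P D -> definable P (~` D).
Proof. by move=> [phi ->]; exists (fneg phi). Qed.

Lemma definableI I (P : set M) (D D' : set (I -> M)) :
  definable P D -> definable P D' -> definable P (D `&` D').
Proof.
move=> [phi ->] [psi ->]; exists (fand phi psi).
by apply/seteqP; split=> a /= /sat_and.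
Qed.

(** This covers enlarging the parameter set, cylinders over one half of a pair, and fibres over a
    point with coordinates in [Q]. *)
Lemma definable_subst I J (P Q : set M) (D : set (J -> M))
    (g : J -> I + set_type Q) : P `<=` Q -> definable P D ->
  definable Q [set a : I -> M | D (fun j =>
    match g j with inl i => a i | inr c => set_val c end)].
Proof.
move=> PQ [phi ->].
exists (fren (fun v => match v with
  | inl j => g j | inr c => inr (to_set (PQ _ (set_valP c))) end) phi).
apply/seteqP; split=> a; rewrite /= /psat sat_ren; apply: sat_ext_imp.
  by move=> [j|c] //=.
by move=> [j|c] //=.
Qed.

Lemma definable_mono I (P Q : set M) (D : set (I -> M)) :
  P `<=` Q -> definable P D -> definable Q D.
Proof. by move=> PQ /(definable_subst (fun i => inl i) PQ). Qed.

Lemma definable_aut I (D : set (I -> M)) (s : M -> M) (a : I -> M) :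
  definable set0 D -> automorphism s -> D (s \o a) <-> D a.
Proof.
move=> [phi ->] sa; rewrite /= /psat -[in X in _ <-> X](sat_aut phi sa).
suff -> : (fun v : I + set_type set0 => match v with
    inl i => (s \o a) i | inr c => set_val c end) = s \o (fun v =>
  match v with inl i => a i | inr c => set_val c end) by [].
by apply/funext => -[//|c]; have := set_valP c.
Qed.

Lemma limit_definable (I T : Type) (P : set M) (F : set_system T)
    (b : T -> I -> M) :
  smallT kappa I -> small kappa P -> UltraFilter F ->
  exists e : I -> M, forall D, definable P D -> D e <-> F [set t | D (b t)].
Proof.
move=> sI sP FU; have [e eP] := limit_over b sI sP FU.
have eP' D : definable P D -> F [set t | D (b t)] -> D e.
  by move=> [phi ->]; exact: eP.
exists e => D defD; split=> [De|]; last exact: eP'.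
apply: contrapT => /(ultra_setC _ FU) nD.
exact: (eP' _ (definableC defD) nD).
Qed.

Lemma type_definableP I (P : set M) (D : set (I -> M)) : type_definable P D ->
  forall a, (forall D', definable P D' -> D `<=` D' -> D' a) -> D a.
Proof.
move=> [Phi ->] a aP phi Pphi; apply: (aP [set a | psat a phi]).
  by exists phi.
by move=> b; apply.
Qed.

End limits.

(** * Piecewise syndetic sets *)

Section piecewise_syndetic.
Variables (T : Type) (C : set T) (G : set (T -> T)).

Definition thick (A : set T) : Prop :=
  forall l : seq (T -> T), (forall t, List.In t l -> G t) ->
  exists x, C x /\ forall t, List.In t l -> A (t x).

Definition psyndetic (A : set T) : Prop :=
  exists l : seq (T -> T), (forall s, List.In s l -> G s) /\
  thick [set x | exists s, List.In s l /\ A (s x)].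

Hypothesis G1 : G id.
Hypothesis GM : forall s t, G s -> G t -> G (s \o t).
Hypothesis GC : forall s x, G s -> C x -> C (s x).

Lemma thick_psyndetic A : thick A -> psyndetic A.
Proof.
move=> thA; exists [:: id]; split=> [s [<-//|//]|l lG].
have [x [Cx xl]] := thA l lG; exists x; split=> // t /xl ?; exists id.
by split=> //; left.
Qed.

Lemma psyndeticS A B : (forall x, C x -> A x -> B x) ->
  psyndetic A -> psyndetic B.
Proof.
move=> AB [l [lG thl]]; exists l; split=> // l' lG'.
have [x [Cx xl']] := thl l' lG'; exists x; split=> // t tl'.
have [s [sl sA]] := xl' t tl'; exists s; split=> //; apply: AB => //.
by apply: GC; [exact: lG|apply: GC => //; exact: lG'].
Qed.

Lemma psyndetic_nonempty A : psyndetic A -> exists2 x, C x & A x.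
Proof.
move=> [l [lG thl]]; have [|x [Cx /(_ id)]] := thl [:: id].
  by move=> t [<-|//].
by case=> [|s [/lG Gs As]]; [left|exists (s x) => //; exact: GC].
Qed.

Lemma psyndetic_preimage s A : G s -> psyndetic [set x | A (s x)] -> psyndetic A.
Proof.
move=> Gs [l [lG thl]]; exists [seq s \o t | t <- l]; split.
  by move=> t /List.in_map_iff[u [<- /lG]]; exact: GM.
move=> l' /thl[x [Cx xl']]; exists x; split=> // t /xl'[u [ul Au]].
by exists (s \o u); split=> //; apply/List.in_map_iff; exists u.
Qed.

(* If the translates of the first part of a thick union fail to be thick, as
   witnessed by [l'], then the [l']-translates of the second part are thick. *)
Lemma psyndeticU A B : psyndetic (A `|` B) -> psyndetic A \/ psyndetic B.
Proof.
move=> [l [lG thl]].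
pose tr (A : set T) := [set x | exists s, List.In s l /\ A (s x)].
have [thA|/existsNP[l' /not_implyP[lG' nA]]] := pselect (thick (tr A)).
  by left; exists l.
right; exists (List.flat_map (fun s => [seq s \o t | t <- l']) l); split.
  move=> u /List.in_flat_map[s [sl /List.in_map_iff[t [<- tl']]]].
  by apply: GM; [exact: lG|exact: lG'].
move=> r rG.
have [|x [Cx xP]] := thl (List.flat_map (fun u => [seq t \o u | t <- l']) r).
  move=> u /List.in_flat_map[s [sr /List.in_map_iff[t [<- tl']]]].
  by apply: GM; [exact: lG'|exact: rG].
exists x; split=> // u ur; apply: contrapT => nB; apply: nA.
exists (u x); split; first by apply: GC => //; exact: rG.
move=> t tl'; have [|s [sl [As|Bs]]] := xP (t \o u).
- by apply/List.in_flat_map; exists u; split=> //; apply/List.in_map_iff; exists t.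
- by exists s.
- exfalso; apply: nB; exists (s \o t); split=> //.
  by apply/List.in_flat_map; exists s; split=> //; apply/List.in_map_iff; exists t.
Qed.

Lemma thick_preimages A (l : seq (T -> T)) : thick A ->
  (forall t, List.In t l -> G t) ->
  thick [set x | forall t, List.In t l -> A (t x)].
Proof.
move=> thA lG r rG.
have [|x [Cx xP]] := thA (List.flat_map (fun u => [seq t \o u | t <- l]) r).
  move=> u /List.in_flat_map[s [sr /List.in_map_iff[t [<- tl]]]].
  by apply: GM; [exact: lG|exact: rG].
exists x; split=> // u ur t tl; apply: (xP (t \o u)).
by apply/List.in_flat_map; exists u; split=> //; apply/List.in_map_iff; exists t.
Qed.

(** The complements of all sets that are not piecewise syndetic are adjoined to [B]. A finite list
    then splits into members [l'] of [B] and complements of sets with union [N]. By [psyndeticU]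
    this [N] is not piecewise syndetic, so it cannot cover, within [C], the intersection of [l']. *)
Lemma ultra_psyndetic (B : set (set T)) :
  (forall l, (forall S, List.In S l -> B S) ->
    psyndetic [set x | forall S, List.In S l -> S x]) ->
  exists F : set_system T,
    [/\ UltraFilter F, B `<=` F & forall S, F S -> psyndetic S].
Proof.
move=> Bps.
have [l lB|F FU BF] := @ultra_above T (B `|` [set S | ~ psyndetic (~` S)]).
  suff [l' [N [lB' nN lN]]] : exists l' N, [/\ forall S, List.In S l' -> B S,
      ~ psyndetic N & forall x, (forall S, List.In S l' -> S x) -> ~ N x ->
      forall S, List.In S l -> S x].
    apply: contrapT => nl; apply: nN; apply: psyndeticS (Bps _ lB') => x _ xl'.
    by apply: contrapT => Nx; apply: nl; exists x; exact: lN.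
  elim: l lB => [|S l IH] lB.
    exists [::], set0; split=> //.
    by move=> /psyndetic_nonempty[].
  have [|l' [N [lB' nN lN]]] := IH; first by move=> S' ?; apply: lB; right.
  have [BS|nS] := lB S (or_introl erefl).
    exists (S :: l'), N; split=> // [S' [<-//|/lB'//]|x xl Nx S' [<-|]].
      by apply: xl; left.
    by apply: lN => // ? ?; apply: xl; right.
  exists l', (N `|` ~` S); split=> //; first by move/psyndeticU => [].
  move=> x xl /not_orP[Nx /contrapT Sx] S' [<-//|]; exact: lN.
exists F; split=> //; first by move=> S BS; apply: BF; left.
move=> S FS; apply: contrapT => nS.
have : F (~` S) by apply: BF; right; rewrite /= setCK.
by move/(ultra_setC _ FU).
Qed.

End piecewise_syndetic.

Definition pair_tuple (I T : Type) (a b : I -> T) (v : I + I) : T :=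
  match v with inl i => a i | inr i => b i end.

(** * Piecewise syndetic sets of tuples in the class [C] *)

Section main.
Variables (L : language) (kappa : Type) (M : structure L) (A : set M).
Variables (alpha : Type) (X C : set (alpha -> M)).
Variables (E : set ((alpha -> M) * (alpha -> M))).
Variables (U : nat -> set ((alpha -> M) * (alpha -> M))).
Variables (Gamma : set (M -> M)).
Hypothesis kappa_nat : smallT kappa nat.
Hypothesis M_sat : saturated kappa M.
Hypothesis M_hom : homogeneous kappa M.
Hypothesis A_small : small kappa A.
Hypothesis alpha_small : smallT kappa alpha.
Hypothesis X_def : type_definable A X.
Hypothesis E_eq : equivalence_on X E.
Hypothesis U_nf : normal_form X E U.
Hypothesis E_bounded : bounded_on kappa X E.
Hypothesis C_class : classes X E C.
Hypothesis C_nsc : ~ strongly_closed C E U.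
Hypothesis Gamma_group : aut_subgroup Gamma.
Hypothesis Gamma_trans : transitive_on Gamma C.
Hypothesis Gamma_classes : preserves_classes Gamma X E.

Lemma CX : C `<=` X.
Proof. by have [a Xa <-] := C_class => b []. Qed.

Lemma C_E a b : C a -> C b -> E (a, b).
Proof.
have [refl sym tr] := E_eq; have [c Xc <-] := C_class => -[Xa ca] [Xb cb].
by apply: (tr _ c) => //; exact: sym.
Qed.

Lemma E_C a b : C a -> X b -> E (a, b) -> C b.
Proof.
have [refl sym tr] := E_eq; have [c Xc <-] := C_class => -[Xa ca] Xb ab.
by split=> //; apply: (tr _ a).
Qed.

Lemma U_E n a b : U n (a, b) -> E (a, b).
Proof. by have [_ -> _ _ _] := U_nf; exists n. Qed.

Lemma E_U a b : E (a, b) -> exists n, U n (a, b).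
Proof. by have [_ -> _ _ _] := U_nf => -[n _ h]; exists n. Qed.

Lemma U_sym n a b : U n (a, b) -> U n (b, a).
Proof. by have [_ _ _ sym _] := U_nf; exact: sym. Qed.

Lemma U_mono n m a b : X a -> X b -> (n <= m)%N -> U n (a, b) -> U m (a, b).
Proof.
have [_ _ U0 _ UU] := U_nf => Xa Xb /subnK<- h.
have Urefl k c : X c -> U k (c, c).
  by move=> Xc; elim: k => [|k IH]; [exact: U0|exact: (UU _ c c c)].
by elim: (m - n)%N => [|k IH]; [|apply: (UU _ _ _ b) => //; exact: Urefl].
Qed.

Lemma U_trans n m a b c : X a -> X b -> X c ->
  U n (a, b) -> U m (b, c) -> U (maxn n m).+1 (a, c).
Proof.
have [_ _ _ _ UU] := U_nf => Xa Xb Xc ab bc.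
apply: (UU _ _ _ b) => //.
  by apply: U_mono ab => //; exact: leq_maxl.
by apply: U_mono bc => //; exact: leq_maxr.
Qed.

Lemma U_defP n a b :
  (forall D, definable set0 D -> as_tuples (U n) `<=` D -> D (pair_tuple a b)) ->
  U n (a, b).
Proof.
by have [Udef _ _ _ _] := U_nf => /(type_definableP (Udef n)).
Qed.

Lemma U_aut_inv s n a b : automorphism s -> U n (s \o a, s \o b) -> U n (a, b).
Proof.
move=> sa ab; apply: U_defP => D Ddef UD.
apply/(definable_aut _ Ddef sa).
have -> : s \o pair_tuple a b = pair_tuple (s \o a) (s \o b).
  by apply/funext => -[].
exact: UD.
Qed.

(** If [C] lay in the [U K]-ball about [c0], composing through [c0] would make [E] equal to [U K.+1]
    on [C]. *)
Lemma C_unbounded c0 K : C c0 -> exists2 c, C c & ~ U K (c0, c).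
Proof.
move=> Cc0; apply: contrapT => h; apply: C_nsc; exists K.+1.
have {}h c : C c -> U K (c0, c).
  by move=> Cc; apply: contrapT => n; apply: h; exists c.
apply/seteqP; split=> -[a b] [/= Uab [Ca Cb]]; split=> //; last exact: U_E Uab.
rewrite -(maxnn K).
by apply: (U_trans (CX Ca) (CX Cc0) (CX Cb)); [apply: U_sym|]; exact: h.
Qed.

(** As [E] is bounded, the set [P] of coordinates of representatives of all classes is small. Two
    independent limits of [Q] have the same type over [P], hence are both [U n]-close to the
    representative [r] of the class of the first. *)
Lemma limit_class (Q : set_system (alpha -> M)) : UltraFilter Q -> Q C ->
  exists n, forall D, definable set0 D -> as_tuples (U n) `<=` D ->
    Q [set a | Q [set b | D (pair_tuple a b)]].
Proof.
move=> QU QC.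
have /choice[rep repP] (K : set_type (classes X E)) :
    exists a : alpha -> M, (set_val K : set _) a.
  have [a Xa Ka] := set_valP K.
  by exists a; rewrite set_valE -Ka; split=> //; have [r _ _] := E_eq; exact: r.
pose par (v : set_type A + set_type (classes X E) * alpha) : M :=
  match v with inl c => set_val c | inr p => rep p.1 p.2 end.
pose P := range par.
have sP : small kappa P.
  apply: small_range; apply: smallT_sum => //; first exact/smallP.
  apply: smallT_prod => //; exact/smallP.
have AP : A `<=` P by move=> c Ac; exists (inl (to_set Ac)).
have P0 : set0 `<=` P by [].
have F2 := ultra_prod QU QU.
have [e eP] := limit_definable M_sat M_hom kappa_nat
  (fun t : (alpha -> M) * (alpha -> M) => pair_tuple t.1 t.2)
  (smallT_sum kappa_nat alpha_small alpha_small) sP F2.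
have X1 : X (e \o inl).
  apply: (type_definableP X_def) => D Ddef XD.
  apply/(eP _ (definable_subst (fun j => inl (inl j)) AP Ddef)).
  apply: (@filterS _ Q) QC => a Ca; apply: (@filterS _ Q) filterT => b _ /=.
  by apply: XD; exact: CX.
have X2 : X (e \o inr).
  apply: (type_definableP X_def) => D Ddef XD.
  apply/(eP _ (definable_subst (fun j => inl (inr j)) AP Ddef)).
  apply: (@filterS _ Q) filterT => a _; apply: (@filterS _ Q) QC => b Cb /=.
  by apply: XD; exact: CX.
have cl : classes X E [set b | X b /\ E (e \o inl, b)] by exists (e \o inl).
have [Xr /E_U[n nr]] := repP (to_set cl).
set r := rep (to_set cl) in Xr nr.
have Pr i : P (r i) by exists (inr (to_set cl, i)).
(* A definable property of the first half and [r] holds for [Q]-almost all tuples in place of that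
   half, and therefore for the second half. *)
have nr' : U n (e \o inr, r).
  apply: U_defP => D Ddef UD.
  pose gl (v : alpha + alpha) : (alpha + alpha) + set_type P :=
    match v with inl i => inl (inl i) | inr i => inr (to_set (Pr i)) end.
  pose gr (v : alpha + alpha) : (alpha + alpha) + set_type P :=
    match v with inl i => inl (inr i) | inr i => inr (to_set (Pr i)) end.
  have El (w : alpha + alpha -> M) : (fun j => match gl j with
      inl i => w i | inr c => set_val c end) = pair_tuple (w \o inl) r.
    by apply/funext => -[].
  have Er (w : alpha + alpha -> M) : (fun j => match gr j with
      inl i => w i | inr c => set_val c end) = pair_tuple (w \o inr) r.
    by apply/funext => -[].
  have := (eP _ (definable_subst gl P0 Ddef)).1; rewrite /= El.
  have Dr : D (pair_tuple (e \o inl) r) by exact: UD.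
  move=> /(_ Dr) Fl.
  have {}Fl : Q [set a | D (pair_tuple a r)].
    by apply: (@filterS _ Q) Fl => a /filter_ex[b] /=; rewrite El.
  have := (eP _ (definable_subst gr P0 Ddef)).2; rewrite /= Er; apply.
  apply: (@filterS _ Q) filterT => a _; apply: (@filterS _ Q) Fl => b /=.
  by rewrite Er.
(* The successor pays for the composition through [r]. *)
exists n.+1 => D Ddef UD; apply/(eP _ (definable_mono P0 Ddef)).
have -> : e = pair_tuple (e \o inl) (e \o inr) by apply/funext => -[].
apply: UD; rewrite -(maxnn n); apply: (U_trans X1 Xr X2) => //; exact: U_sym.
Qed.

Definition act (s : M -> M) (a : alpha -> M) : alpha -> M := s \o a.

Let G := act @` Gamma.

Let Gaut s : Gamma s -> automorphism s.
Proof. by have [h _ _ _] := Gamma_group => /h. Qed.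

Lemma act1 : G id.
Proof. by have [_ h _ _] := Gamma_group; exists id. Qed.

Lemma actM s t : G s -> G t -> G (s \o t).
Proof.
have [_ _ h _] := Gamma_group.
by move=> [s' Gs <-] [t' Gt <-]; exists (s' \o t') => //; exact: h.
Qed.

Lemma actC s a : G s -> C a -> C (s a).
Proof.
by move=> [s' Gs <-] Ca; rewrite -(Gamma_classes Gs C_class); exists a.
Qed.

Notation ps := (psyndetic C G).

(** The radius [n] is fixed by the limit of [Q] before [N] is given; only the centre [c] depends on
    [N]. So the centre can go away from [c0] while the size of the ball stays the same. *)
Lemma psyndetic_U_ball c0 Z : C c0 -> ps Z -> exists n, forall N, exists c,
  [/\ C c, ~ U N (c0, c) & forall D, definable set0 D ->
    as_tuples (U n) `<=` D -> ps [set b | D (pair_tuple c b) /\ Z b]].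
Proof.
move=> Cc0 [l [lG thl]].
pose W := [set x | exists s, List.In s l /\ Z (s x)].
have [k kB|Q [QU QW Qps]] := @ultra_psyndetic _ C G act1 actM actC
    ([set [set x | W (t x)] | t in G] `|` [set C]).
  suff [r rG rP] : exists2 r, (forall t, List.In t r -> G t) &
      forall x, C x -> (forall t, List.In t r -> W (t x)) ->
      forall S, List.In S k -> S x.
    apply: (psyndeticS actC (A := [set x | forall t, List.In t r -> W (t x)])).
      exact: rP.
    by apply: thick_psyndetic act1 _ _; exact: thick_preimages actM _ _ thl rG.
  elim: k kB => [|S k IH] kB; first by exists [::].
  have [|r rG rP] := IH; first by move=> S' ?; apply: kB; right.
  have [[t Gt tS]|SC] := kB S (or_introl erefl).
    exists (t :: r) => [u [<-//|/rG//]|x Cx xP S' [<-|]].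
      by rewrite -tS /=; apply: xP; left.
    by apply: rP => // u ur; apply: xP; right.
  by exists r => // x Cx xP S' [<-|]; [rewrite SC|exact: rP].
have QC : Q C by apply: QW; right.
have [n nP] := limit_class QU QC; exists n => N.
(* Some [t] in [Gamma] moves a [Q]-typical centre [a] to [c]. The [Q]-large set of [b] with [D] at
   [(a, b)] and [W] at [t \o b] lies in the preimage under [t] of the required set. *)
have ball c D : C c -> definable set0 D -> as_tuples (U n) `<=` D ->
    ps [set b | D (pair_tuple c b) /\ W b].
  move=> Cc Ddef UD.
  have [a [Qa Ca]] := filter_ex (filterI (nP D Ddef UD) QC).
  have [t Gt tac] := Gamma_trans Ca Cc.
  have Gat : G (act t) by exists t.
  apply: (psyndetic_preimage actM Gat); apply: Qps.
  apply: (@filterS _ Q) (filterI (Qa : Q _) (QW _ (or_introl (ex_intro2 _ _ _ Gat erefl)))).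
  move=> b [Dab Wb]; split=> //=.
  rewrite -tac /act.
  have -> : pair_tuple (t \o a) (t \o b) = t \o pair_tuple a b.
    by apply/funext => -[].
  by apply/definable_aut => //; exact: Gaut.
(* The final centre is one of the [s c], so all of them must be far from [c0]. If [s' \o d = c0],
   then [s' \o c] is close to [c0] only when [c] is close to [d]; since [l] is finite, it suffices
   that [c] avoids one large ball about [c0]. *)
have [c Cc cl] : exists2 c, C c & forall s, List.In s l -> ~ U N (c0, s c).
  suff [K KP] : exists K, forall c s, C c -> List.In s l -> U N (c0, s c) ->
      U K (c0, c).
    have [c Cc nc] := C_unbounded K Cc0; exists c => // s sl /(KP _ _ Cc sl).
    exact: nc.
  elim: l lG {thl W Q QU QW Qps QC nP ball} => [|s l IH] lG; first by exists 0%N.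
  have [|K KP] := IH; first by move=> ? ?; apply: lG; right.
  have [s' Gs' ss'] := lG s (or_introl erefl).
  have [d Cd dc0] : exists2 d, C d & s' \o d = c0.
    have : C c0 := Cc0; rewrite -{1}(Gamma_classes Gs' C_class) => -[d Cd <-].
    by exists d.
  have [k kd] := E_U (C_E Cc0 Cd).
  exists (maxn K (maxn k N).+1) => c u Cc [<-|ul] Uc; last first.
    apply: U_mono (KP _ _ Cc ul Uc); rewrite ?leq_maxl //; exact: CX.
  have dcN : U N (d, c).
    by apply: (U_aut_inv (Gaut Gs')); rewrite dc0; rewrite -ss' in Uc.
  apply: U_mono (U_trans (CX Cc0) (CX Cd) (CX Cc) kd dcN);
    rewrite ?leq_maxr //; exact: CX.
suff [s sl sP] : exists2 s, List.In s l & forall D, definable set0 D ->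
    as_tuples (U n) `<=` D -> ps [set b | D (pair_tuple c b) /\ Z (s b)].
  exists (s c); split; [exact: actC (lG _ sl) Cc|exact: cl|].
  move=> D Ddef UD; apply: (psyndetic_preimage actM (lG _ sl)).
  apply: psyndeticS (sP D Ddef UD) => //; first exact: actC.
  move=> b _ /= [Db Zb]; split=> //; have [s' Gs' <-] := lG _ sl; rewrite /act.
  have -> : pair_tuple (s' \o c) (s' \o b) = s' \o pair_tuple c b.
    by apply/funext => -[].
  by apply/definable_aut => //; exact: Gaut.
(* If every [s] failed for some definable set, the intersection of these finitely many sets would
   contradict [ball], by [psyndeticU]. *)
apply: contrapT => nl.
suff [D [Ddef UD DP]] : exists D, [/\ definable set0 D, as_tuples (U n) `<=` D &
    ~ ps [set b | D (pair_tuple c b) /\ exists s, List.In s l /\ Z (s b)]].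
  by apply: DP; exact: ball.
have {}nl s : List.In s l -> exists D, [/\ definable set0 D,
    as_tuples (U n) `<=` D & ~ ps [set b | D (pair_tuple c b) /\ Z (s b)]].
  move=> sl; apply: contrapT => h; apply: nl; exists s => // D Ddef UD.
  by apply: contrapT => nD; apply: h; exists D.
elim: l nl {lG thl W Q QU QW Qps QC nP ball cl} => [|s l IH] nl.
  exists setT; split=> //; first exact: definableT.
  by move=> /(psyndetic_nonempty act1 actC)[b _ [_ [s []]]].
have [|D [Ddef UD nD]] := IH; first by move=> ? ?; apply: nl; right.
have [D' [Ddef' UD' nD']] := nl s (or_introl erefl).
exists (D `&` D'); split; first exact: definableI.
  by move=> w Uw; split; [exact: UD|exact: UD'].
move=> h; have : ps ([set b | D (pair_tuple c b) /\ exists s, List.In s l /\ Z (s b)]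
    `|` [set b | D' (pair_tuple c b) /\ Z (s b)]).
  apply: psyndeticS h; first exact: actC.
  move=> b _ [[Db Db'] [u [[<-|ul] Zu]]]; first by right.
  by left; split=> //; exists u.
by move/(psyndeticU actM actC) => [].
Qed.

End main.

(** * Small elementary submodels *)

Section small_model.
Variables (L : language) (kappa : Type) (M : structure L).
Hypothesis kappa_nat : smallT kappa nat.
Hypothesis kappa_L : smallT kappa (fsym L + rsym L).

Section hull.
Variables (B : Type) (d : M) (op : B -> seq M -> M).

(** Trees serve as closed terms: a leading leaf names the operation, and the subtrees after it are
    the arguments. Nodes of any other shape get the default [d]. *)
Fixpoint hull_eval (t : GenTree.tree B) : M :=
  match t with
  | GenTree.Leaf b => op b [::]
  | GenTree.Node _ ts =>
    if ts is GenTree.Leaf b :: ts' then op b (map hull_eval ts') else d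
  end.

Lemma hull_op b (V : Type) (s : V -> M) (l : seq V) :
  (forall v, range hull_eval (s v)) -> range hull_eval (op b (map s l)).
Proof.
move=> sN.
have /choice[t tE] v : exists t, hull_eval t = s v.
  by have [t _ E] := sN v; exists t.
exists (GenTree.Node 0 (GenTree.Leaf b :: map t l)) => //=.
by rewrite -map_comp (eq_map (g := s)).
Qed.

End hull.

(** The Tarski-Vaught test, for all variable types at once because the induction goes under
    quantifiers. *)
Lemma elementary_witness (N : substructure M) :
  (forall (V : Type) (phi : form L (option V)) (e : V -> set_type N) x,
    sat phi (oapp (set_val \o e) x) ->
    exists2 y, sub_dom N y & sat phi (oapp (set_val \o e) y)) ->
  elementary N.
Proof.
move=> tv.
have tevalE V (t : term L V) (f : V -> set_type N) :
    set_val (teval (M := induced_structure N) f t) = teval (set_val \o f) t.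
  elim: t => //= g args IH; congr fint; apply/funext => i /=; exact: IH.
suff gen V (phi : form L V) : forall e : V -> set_type N,
    sat (M := induced_structure N) phi e <-> sat phi (set_val \o e).
  by move=> phi e; exact: gen.
elim: phi => {V} [V|V t u|V r args|V phi IH1 psi IH2|V phi IH] e /=.
- by [].
- by rewrite -!tevalE; split=> [->//|/set_val_inj].
- by under [in X in _ <-> X]eq_fun do rewrite -tevalE.
- by rewrite IH1 IH2.
have E (x : set_type N) : set_val \o oapp e x = oapp (set_val \o e) (set_val x).
  by apply/funext; case.
split=> h x; last by apply/IH; rewrite E.
apply: contrapT => nx.
have [y Ny] := tv _ (fneg phi) e x nx; apply.
by have /IH := h (to_set Ny); rewrite E.
Qed.

Lemma small_model (I : Type) (S : set M) (ch : set (I -> M) -> nat -> I -> M) :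
  smallT kappa I -> small kappa S ->
  exists N : substructure M, [/\ elementary N, small kappa N, S `<=` N &
    forall D, definable N D -> forall k i, sub_dom N (ch D k i)].
Proof.
move=> sI sS; have [d] := carrier_inhabited M.
pose B : Type := (fsym L + form L (unit + nat) +
  (form L (I + nat) * nat * I + set_type S))%type.
pose asg V (s : seq M) (a : V -> M) (v : V + nat) : M :=
  match v with inl i => a i | inr k => nth d s k end.
have /choice[sk skP] (p : form L (unit + nat) * seq M) : exists x : M,
    forall y, sat p.1 (asg _ p.2 (fun=> y)) -> sat p.1 (asg _ p.2 (fun=> x)).
  have [[y hy]|n] := pselect (exists y, sat p.1 (asg _ p.2 (fun=> y))).
    by exists y.
  by exists d => y hy; case: n; exists y.
pose op (b : B) (s : seq M) : M :=
  match b with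
  | inl (inl f) => fint M f (fun i => nth d s i)
  | inl (inr phi) => sk (phi, s)
  | inr (inl p) => ch [set a | sat p.1.1 (asg _ s a)] p.1.2 p.2
  | inr (inr c) => set_val c
  end.
pose N0 := range (hull_eval d op).
have opN b V (s : V -> M) l : (forall v, N0 (s v)) -> N0 (op b (map s l)).
  exact: hull_op.
have N0d : N0 !=set0.
  by exists d; exists (GenTree.Node 0 [::]).
have N0f (f : fsym L) (args : 'I_(fsym_arity f) -> M) :
    (forall i, N0 (args i)) -> N0 (fint M f args).
  move=> /(opN (inl (inl f)) _ args (enum 'I_(fsym_arity f))) /=.
  rewrite (_ : (fun i => _) = args) //; apply/funext => i.
  by rewrite (nth_map i) ?size_enum_ord // nth_ord_enum.
exists (Substructure N0d N0f); split.
- apply: elementary_witness => V phi e x phix.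
  have [psi [l psiE]] := form_params
    (fren (fun o => if o is Some v then inr v else inl tt) phi : form L (unit + V)).
  have {}psiE y : sat phi (oapp (set_val \o e) y) <->
      sat psi (asg _ [seq set_val (e v) | v <- l] (fun=> y)).
    have := psiE M (fun=> y) (set_val \o e) d; rewrite sat_ren => <-.
    by apply: sat_ext => -[].
  exists (sk (psi, [seq set_val (e v) | v <- l])).
    by apply: (opN (inl (inr psi))) => v; exact: set_valP.
  by apply/psiE; apply: (skP (psi, _) x); apply/psiE.
- apply: small_range; apply: smallT_tree => //.
  have sform V : smallT kappa V -> smallT kappa (form L (V + nat)).
    by move=> sV; apply: smallT_form => //; exact: smallT_sum.
  have sf : smallT kappa (fsym L).
    by apply: smallT_le kappa_L; exists inl => ? ? [].
  have su : smallT kappa unit by exact: smallT_countable.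
  apply: smallT_sum => //; apply: smallT_sum => //; first exact: sform.
    by apply: smallT_prod => //; apply: smallT_prod => //; exact: sform.
  exact/smallP.
- by move=> c Sc; exists (GenTree.Leaf (inr (inr (to_set Sc)))).
- move=> D [phi ->] k i.
  have [psi [l psiE]] := form_params phi.
  have := opN (inr (inl (psi, k, i))) _ set_val l (@set_valP _ N0).
  rewrite /=; congr (N0 (ch _ _ _)).
  by apply/seteqP; split=> a /=; rewrite /psat (psiE _ _ _ d).
Qed.

End small_model.

(** * The tree of Choquet games *)

Section stone_subspace.
Variables (L : language) (M : structure L) (N : set M) (I : Type).
Variable Y : set (I -> M).

Notation Z := (set_type (type_space (A := N) Y)).

Definition realizes (z : Z) (e : I -> M) : Prop := set_val z = tp N e.

Lemma realizes_exists e : Y e -> exists z : Z, realizes z e.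
Proof. by move=> Ye; have h : type_space (A := N) Y (tp N e);
  [exists e|exists (to_set h)]. Qed.

Lemma realized (z : Z) : exists2 e, Y e & realizes z e.
Proof. by have [e Ye h] := set_valP z; exists e. Qed.

Lemma realizes_psat (z : Z) e (phi : pform N I) : realizes z e ->
  stone_basic phi (set_val z) <-> psat e phi.
Proof. by rewrite /realizes => ->. Qed.

Lemma open_stone_basic (phi : pform N I) : open (stone_basic phi).
Proof.
exists [set phi] => //; apply/seteqP; split=> [p [psi -> //]|p h]; by exists phi.
Qed.

Lemma open_definable (D : set (I -> M)) : definable N D ->
  exists O : set Z, open O /\ forall z e, realizes z e -> O z <-> D e.
Proof.
move=> [phi ->]; exists (set_val @^-1` stone_basic phi); split.
  by exists (stone_basic phi) => //; exact: open_stone_basic.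
by move=> z e ze; exact: realizes_psat.
Qed.

Lemma open_realizes (O : set Z) (z : Z) e : open O -> O z -> realizes z e ->
  exists2 D, definable N D /\ D e &
    forall z' e', realizes z' e' -> D e' -> O z'.
Proof.
move=> [B [F _ <-] <-] [phi Fphi zphi] ze.
exists [set a | psat a phi]; first by split; [exists phi|exact/(realizes_psat phi ze)].
by move=> z' e' ze' h; exists phi => //; exact/(realizes_psat phi ze').
Qed.

End stone_subspace.

Section tree.
Variables (L : language) (kappa : Type) (M : structure L) (A : set M).
Variables (alpha : Type) (X Y C : set (alpha -> M)).
Variables (E : set ((alpha -> M) * (alpha -> M))).
Variables (U : nat -> set ((alpha -> M) * (alpha -> M))).
Variables (Gamma : set (M -> M)).
Hypothesis kappa_nat : smallT kappa nat.
Hypothesis M_sat : saturated kappa M.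
Hypothesis M_hom : homogeneous kappa M.
Hypothesis alpha_small : smallT kappa alpha.
Hypothesis X_def : type_definable A X.
Hypothesis E_eq : equivalence_on X E.
Hypothesis U_nf : normal_form X E U.
Hypothesis C_class : classes X E C.
Hypothesis Gamma_group : aut_subgroup Gamma.
Hypothesis Gamma_classes : preserves_classes Gamma X E.
Hypothesis CY : C `<=` Y.
Hypothesis YX : Y `<=` X.

Variables (N : set M) (c0 : alpha -> M).
Hypothesis N_small : small kappa N.
Hypothesis AN : A `<=` N.
Hypothesis Cc0 : C c0.
Hypothesis Nc0 : forall i, N (c0 i).

Notation ps := (psyndetic C (@act L M alpha @` Gamma)).

Hypothesis N_ball : forall D, definable N D -> ps D ->
  exists n, forall K, exists c, [/\ C c, forall i, N (c i), ~ U K (c0, c) &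
    forall D', definable set0 D' -> as_tuples (U n) `<=` D' ->
      ps [set b | D' (pair_tuple c b) /\ D b]].

Let N0 : set0 `<=` N. Proof. by []. Qed.

Lemma definable_left (c : alpha -> M) (D : set (alpha + alpha -> M)) :
  (forall i, N (c i)) -> definable set0 D ->
  definable N [set b | D (pair_tuple c b)].
Proof.
move=> Nc Ddef; pose g (v : alpha + alpha) : alpha + set_type N :=
  match v with inl i => inr (to_set (Nc i)) | inr i => inl i end.
have := definable_subst g N0 Ddef; congr (definable _ _).
apply/seteqP; split=> b /=; rewrite (_ : (fun j => _) = pair_tuple c b) //;
  by apply/funext => -[].
Qed.

Definition big (e : alpha -> M) : Prop :=
  C e /\ forall D, definable N D -> D e -> ps D.

(** The limit of an ultrafilter of piecewise syndetic sets is big. Putting into the ultrafilter the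
    part of [D] near a remote centre [c] makes the limit [U n]-close to [c], hence a member of [C]
    far from [c0]. *)
Lemma big_point D K : definable N D -> ps D ->
  exists e, [/\ big e, D e & ~ U K (c0, e)].
Proof.
move=> Ddef psD; have [n nP] := N_ball Ddef psD.
(* From [U K (c0, e)] and [U n (c, e)] would follow [U (maxn K n).+1 (c0, c)]. *)
have [c [Cc Nc nUc cP]] := nP (maxn K n).+1.
have sc := @actC L M alpha X C E Gamma C_class Gamma_classes.
have s1 := @act1 L M alpha Gamma Gamma_group.
have sM := @actM L M alpha Gamma Gamma_group.
pose B := [set S | exists D', [/\ definable set0 D', as_tuples (U n) `<=` D' &
  S = [set b | D' (pair_tuple c b) /\ D b]]].
have [l lB|Q [QU QB Qps]] := @ultra_psyndetic _ C _ s1 sM sc (B `|` [set C]).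
  suff [D' [Ddef' UD' DP]] : exists D', [/\ definable set0 D',
      as_tuples (U n) `<=` D' & forall b, C b -> D' (pair_tuple c b) -> D b ->
        forall S, List.In S l -> S b].
    apply: psyndeticS (cP _ Ddef' UD'); first exact: sc.
    by move=> b Cb [D'b Db]; exact: DP.
  elim: l lB => [|S l IH] lB.
    by exists setT; split=> //; exact: definableT.
  have [|D' [Ddef' UD' DP]] := IH; first by move=> ? ?; apply: lB; right.
  have [[D'' [Ddef'' UD'' ->]]|->] := lB S (or_introl erefl); last first.
    by exists D'; split=> // b Cb Db' Db S' [<-//|]; exact: DP.
  exists (D' `&` D''); split; first exact: definableI.
    by move=> w Uw; split; [exact: UD'|exact: UD''].
  by move=> b Cb [Db' Db''] Db S' [<-//|]; exact: DP.
have QC : Q C by apply: QB; right.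
have QcD D' : definable set0 D' -> as_tuples (U n) `<=` D' ->
    Q [set b | D' (pair_tuple c b) /\ D b].
  by move=> ? ?; apply: QB; left; exists D'.
have [e eP] := limit_definable M_sat M_hom kappa_nat id alpha_small N_small QU.
have Xe : X e.
  apply: (type_definableP X_def) => D' Ddef' XD'.
  apply/(eP _ (definable_mono AN Ddef')).
  by apply: (@filterS _ Q) QC => a Ca; apply: XD'; exact: (CX C_class).
have Uce : U n (c, e).
  apply: (U_defP U_nf) => D' Ddef' UD'.
  apply/(eP _ (definable_left Nc Ddef')).
  by apply: (@filterS _ Q) (QcD _ Ddef' UD') => b [].
exists e; split.
- split; first exact: (E_C E_eq C_class Cc Xe (U_E U_nf Uce)).
  by move=> D' Ddef' /(eP _ Ddef'); exact: Qps.
- apply/(eP _ Ddef).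
  by apply: (@filterS _ Q) (QcD setT (@definableT _ _ _ _) (fun _ _ => I)) => b [].
- move=> UKe; apply: nUc.
  apply: (U_trans U_nf (CX C_class Cc0) Xe (CX C_class Cc) UKe).
  exact: (U_sym U_nf).
Qed.

(** By compactness, a failure yields [w] in [U m] whose halves have the types of [e] and [e'] over
    [N]. As [c0] has coordinates in [N], the first half is [U k]-close to [c0]; so the second half,
    and with it [e'], would be in the excluded ball about [c0]. *)
Lemma separation k m e e' : X e -> X e' -> U k (c0, e) ->
  ~ U (maxn k m).+1 (c0, e') ->
  exists D D', [/\ definable N D, definable N D', D e, D' e' &
    forall a b, X a -> X b -> D a -> D' b -> ~ U m (a, b)].
Proof.
move=> Xe Xe' Uke nUe'; apply: contrapT => nsep.
pose rect (D D' : set (alpha -> M)) : set ((alpha -> M) * (alpha -> M)) :=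
  [set p | [/\ X p.1, X p.2, D p.1, D' p.2 & U m p]].
have [l lB|F FU BF] := @ultra_above _ [set S | exists D D',
    [/\ definable N D, definable N D', D e, D' e' & S = rect D D']].
  suff [D [D' [Ddef Ddef' De De' DP]]] : exists D D', [/\ definable N D,
      definable N D', D e, D' e' & forall p, rect D D' p ->
        forall S, List.In S l -> S p].
    apply: contrapT => nl; apply: nsep; exists D, D'; split=> // a b Xa Xb Da Db Uab.
    by apply: nl; exists (a, b); apply: DP.
  elim: l lB => [|S l IH] lB.
    by exists setT, setT; split=> //; exact: definableT.
  have [|D [D' [Ddef Ddef' De De' DP]]] := IH.
    by move=> ? ?; apply: lB; right.
  have [D2 [D2' [D2def D2def' D2e D2e' ->]]] := lB S (or_introl erefl).
  exists (D `&` D2), (D' `&` D2'); split=> //; try exact: definableI.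
  by move=> p [Xa Xb [Da D2a] [Db D2b] Up] S' [<-//|]; apply: DP.
have FX : F [set p | [/\ X p.1, X p.2 & U m p]].
  have := BF (rect setT setT).
  move=> /(_ (ex_intro _ setT (ex_intro _ setT _))) FT.
  have : F (rect setT setT).
    by apply: FT; split=> //; exact: definableT.
  by apply: (@filterS _ F) => p [].
have [w wP] := limit_definable M_sat M_hom kappa_nat
  (fun t : (alpha -> M) * (alpha -> M) => pair_tuple t.1 t.2)
  (smallT_sum kappa_nat alpha_small alpha_small) N_small FU.
have wl D : definable N D -> D (w \o inl) <-> F [set t | D t.1].
  by move=> Ddef; exact: (wP _ (definable_subst (fun j => inl (inl j)) (@subset_refl _ N) Ddef)).
have wr D : definable N D -> D (w \o inr) <-> F [set t | D t.2].
  by move=> Ddef; exact: (wP _ (definable_subst (fun j => inl (inr j)) (@subset_refl _ N) Ddef)).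
have el D : definable N D -> D e -> D (w \o inl).
  move=> Ddef De; apply/(wl _ Ddef).
  have : F (rect D setT).
    by apply: BF; exists D, setT; split=> //; exact: definableT.
  by apply: (@filterS _ F) => p [].
have er D : definable N D -> D e' -> D (w \o inr).
  move=> Ddef De'; apply/(wr _ Ddef).
  have : F (rect setT D).
    by apply: BF; exists setT, D; split=> //; exact: definableT.
  by apply: (@filterS _ F) => p [].
have X1 : X (w \o inl).
  apply: (type_definableP X_def) => D Ddef XD.
  by apply: el; [exact: definable_mono AN Ddef|exact: XD].
have X2 : X (w \o inr).
  apply: (type_definableP X_def) => D Ddef XD.
  by apply: er; [exact: definable_mono AN Ddef|exact: XD].
have Uk : U k (c0, w \o inl).
  apply: (U_defP U_nf) => D Ddef UD.
  by apply: (el _ (definable_left Nc0 Ddef)); apply: UD.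
have Um : U m (w \o inl, w \o inr).
  apply: (U_defP U_nf) => D Ddef UD.
  have -> : pair_tuple (w \o inl) (w \o inr) = w by apply/funext => -[].
  apply/(wP _ (definable_mono N0 Ddef)).
  by apply: (@filterS _ F) FX => -[a b] [_ _ Uab]; exact: UD.
apply: nUe'; apply: (U_defP U_nf) => D Ddef UD; apply: contrapT => nD.
have := er _ (definableC (definable_left Nc0 Ddef)) nD; apply.
apply: UD.
exact: (U_trans U_nf (CX C_class Cc0) X1 X2 Uk Um).
Qed.

Notation Z := (set_type (type_space (A := N) Y)).

Definition big_type (z : Z) : Prop := exists2 e, big e & realizes z e.

(** The two types over [N] need not decide [U m], so all realizations in [X] are considered. *)
Definition apart m (O O' : set Z) : Prop :=
  forall z z' a b, realizes z a -> realizes z' b -> X a -> X b ->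
    O z -> O' z' -> ~ U m (a, b).

Lemma apart_sym m O O' : apart m O O' -> apart m O' O.
Proof.
move=> h z z' a b za zb Xa Xb Oz Oz' /(U_sym U_nf).
exact: (h z' z b a).
Qed.

(** The points are chosen successively in the order of [pickle], each so far from [c0] that
    [separation] applies against all earlier ones. *)
Lemma apart_points (J : countType) m (W : J -> set Z) :
  (forall j, open (W j) /\ exists2 z, W j z & big_type z) ->
  exists z : J -> Z, (forall j, W j (z j) /\ big_type (z j)) /\
    forall i j, i != j -> exists G G' : set Z,
      [/\ open G, open G', G (z i), G' (z j) & apart m G G'].
Proof.
move=> WP.
have nxt (p : J * nat) : exists r : (alpha -> M) * Z * nat,
    [/\ big r.1.1, realizes r.1.2 r.1.1 /\ W p.1 r.1.2,
      ~ U (maxn p.2 m).+1 (c0, r.1.1), U r.2 (c0, r.1.1) & (p.2 <= r.2)%N].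
  case: p => j K /=; have [Wo [z Wz [e0 [_ e0ps] ze0]]] := WP j.
  have [D [Ddef De0] DP] := open_realizes Wo Wz ze0.
  have [e [be De nU]] := big_point (maxn K m).+1 Ddef (e0ps _ Ddef De0).
  have [z' z'e] := realizes_exists N (CY be.1).
  have [k Uk] := E_U U_nf (C_E E_eq C_class Cc0 be.1).
  exists (e, z', maxn K k); split=> //=; last exact: leq_maxl.
    by split=> //; exact: DP De.
  by apply: (U_mono U_nf _ _ (leq_maxr _ _) Uk); apply: (CX C_class) => //; case: be.
have [r rP] := choice nxt.
(* [bound n] is the radius of a ball about [c0] containing all the points whose code is below [n];
   it stays the same at numbers that decode to nothing. *)
pose bound := fix bound n := if n is n'.+1 then
  (if unpickle n' is Some j then (r (j, bound n')).2 else bound n') else 0%N.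
have boundS n : (bound n <= bound n.+1)%N.
  by rewrite /=; case: unpickle => // j; have [] := rP (j, bound n).
have bound_mono := homo_leq (@leqnn) leq_trans boundS.
pose f j := r (j, bound (pickle j)).
have boundE j : bound (pickle j).+1 = (f j).2 by rewrite /= pickleK.
exists (fun j => (f j).1.2); split.
  by move=> j; have [bj [zj Wj] _ _ _] := rP (j, bound (pickle j)); split=> //;
    exists (f j).1.1.
have Xbig e : big e -> X e by move=> [/(CX C_class)].
have main i j : (pickle i < pickle j)%N -> exists G G' : set Z,
    [/\ open G, open G', G (f i).1.2, G' (f j).1.2 & apart m G G'].
  move=> /bound_mono ij.
  have [bi [zi _] _ Ui _] := rP (i, bound (pickle i)).
  have [bj [zj _] nUj _ _] := rP (j, bound (pickle j)).
  have Uij : U (bound (pickle j)) (c0, (f i).1.1).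
    by apply: (U_mono U_nf (CX C_class Cc0) (Xbig _ bi) _ Ui); rewrite -boundE.
  have [D [D' [Ddef Ddef' De De' DP]]] := separation (Xbig _ bi) (Xbig _ bj) Uij nUj.
  have [G [Go OP]] := open_definable Y Ddef.
  have [G' [Go' OP']] := open_definable Y Ddef'.
  exists G, G'; split=> //; first exact/(OP _ _ zi).
    exact/(OP' _ _ zj).
  by move=> z z' a b za zb Xa Xb /(OP _ _ za) Da /(OP' _ _ zb) Db; exact: DP.
move=> i j ij; case: (ltngtP (pickle i) (pickle j)).
- exact: main.
- by move=> /main[G [G' [? ? ? ? /apart_sym ?]]]; exists G', G.
- by move=> /(pcan_inj pickleK) ijE; rewrite ijE eqxx in ij.
Qed.

(** As [J] is finite, each point can keep the intersection of its neighbourhoods against all the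
    others, in both positions of the pair. *)
Lemma apart_opens (J : finType) m (W : J -> set Z) :
  (forall j, open (W j) /\ exists2 z, W j z & big_type z) ->
  exists (G : J -> set Z) (z : J -> Z),
    (forall j, [/\ open (G j), G j (z j), G j `<=` W j & big_type (z j)]) /\
    forall i j, i != j -> apart m (G i) (G j).
Proof.
move=> WP; have [z [zW zap]] := apart_points m WP.
have /choice[V VP] (p : J * J) : exists P : set Z * set Z, p.1 != p.2 ->
    [/\ open P.1, open P.2, P.1 (z p.1), P.2 (z p.2) & apart m P.1 P.2].
  have [_|ne] := eqVneq p.1 p.2; first by exists (setT, setT).
  by have [G [G' h]] := zap _ _ ne; exists (G, G').
have /choice[G OP] (i : J) : exists G : set Z, [/\ open G, G (z i), G `<=` W i &
    forall j, i != j -> G `<=` (V (i, j)).1 /\ G `<=` (V (j, i)).2].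
  have : nbhs (z i) [set x | W i x /\
      forall j, i != j -> (V (i, j)).1 x /\ (V (j, i)).2 x].
    have n0 : nbhs (z i) (W i).
      by apply: open_nbhs_nbhs; split; [case: (WP i)|case: (zW i)].
    suff n1 : nbhs (z i) [set x | forall j, i != j ->
        (V (i, j)).1 x /\ (V (j, i)).2 x].
      by apply: filterS (filterI n0 n1).
    pose near_j j x := i != j -> (V (i, j)).1 x /\ (V (j, i)).2 x.
    suff nj j : nbhs (z i) (near_j j).
      exact: (@filter_forall _ J near_j (nbhs (z i)) (nbhs_filter (z i)) nj).
    rewrite /near_j.
    have [->|ij] := eqVneq i j; first exact: filterS filterT.
    have [p1 _ h1 _ _] := VP (i, j) ij.
    have ji : j != i by rewrite eq_sym.
    have [_ p2 _ h2 _] := VP (j, i) ji.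
    have n1 : nbhs (z i) (V (i, j)).1 by apply: open_nbhs_nbhs.
    have n2 : nbhs (z i) (V (j, i)).2 by apply: open_nbhs_nbhs.
    by apply: filterS (filterI n1 n2).
  rewrite nbhsE => -[G [Go Oz] OP]; exists G; split=> //.
    by move=> x /OP[].
  by move=> j ij; split=> x /OP[_ /(_ _ ij)[]].
exists G, z; split.
  by move=> j; have [? ? ? _] := OP j; have [_ ?] := zW j.
move=> i j ij; have [_ _ _ _ ap] := VP (i, j) ij.
have [_ _ _ /(_ _ ij)[Oi _]] := OP i.
have ji : j != i by rewrite eq_sym.
have [_ _ _ /(_ _ ji)[_ Oj]] := OP j.
by move=> x y a b xa yb Xa Xb /Oi ? /Oj ?; exact: (ap x y).
Qed.

(** The condition on [W] stands inside the existential, so that [choice] yields a rule for whole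
    levels before the answers of B are known to meet it. *)
Lemma apart_moves n m (W : seq bool -> set Z) : exists mv : seq bool -> set Z * Z,
  (forall s, size s = n -> open (W s) /\ exists2 z, W s z & big_type z) ->
  (forall s, size s = n -> [/\ open (mv s).1, (mv s).1 (mv s).2,
     (mv s).1 `<=` W s & big_type (mv s).2]) /\
  forall s t, size s = n -> size t = n -> s != t -> apart m (mv s).1 (mv t).1.
Proof.
have [WP|nW] := pselect
  (forall s, size s = n -> open (W s) /\ exists2 z, W s z & big_type z); last first.
  have [z0 _] := realizes_exists N (CY Cc0).
  by exists (fun=> (setT, z0)) => /nW.
have [t|G [z [Oz Oap]]] := @apart_opens (n.-tuple bool) m (W \o val).
  by apply: WP; rewrite size_tuple.
have [z0 _] := realizes_exists N (CY Cc0).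
exists (fun s => if insub s is Some t then (G t, z t) else (setT, z0)) => _.
have insubE s : size s = n -> exists2 t : n.-tuple bool,
    s = val t & insub s = Some t.
  move=> ss; have sn : size s == n by apply/eqP.
  by exists (Tuple sn); rewrite ?insubT.
split; first by move=> _ /insubE[t -> ->]; exact: Oz.
move=> _ _ /insubE[t -> ->] /insubE[u -> ->] tu; apply: Oap.
by apply: contra_neq tu => ->.
Qed.

Lemma strong_choquet_classes : strong_choquet Z ->
  exists y : (nat -> bool) -> alpha -> M, (forall f, Y (y f)) /\
    forall f g, f <> g -> ~ E (y f, y g).
Proof.
move=> [sB sBP].
have psT : ps setT.
  apply: thick_psyndetic; first exact: act1.
  by move=> l _; exists c0.
have [e0 [be0 _ _]] := big_point 0%N (@definableT _ _ _ _) psT.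
have [z0 z0e] := realizes_exists N (CY be0.1).
have /choice[step stepP] (p : nat * (seq bool -> set Z)) := apart_moves p.1 p.1 p.2.
(* [hist n s] lists the moves of A on the path to the node [s] of length [n]. After the trivial
   opening [(setT, z0)], level [n] is played at once against the answers at the parents
   [take n' s'], with open sets pairwise apart for [U n]. *)
pose hist := fix hist n : seq bool -> seq (set Z * Z) :=
  if n is n'.+1 then fun s => rcons (hist n' (take n' s))
    (step (n, fun s' => sB (hist n' (take n' s'))) s)
  else fun=> [:: (setT, z0)].
pose mv n s : set Z * Z := if n is n'.+1 then
  step (n, fun s' => sB (hist n' (take n' s'))) s else (setT, z0).
pose br (f : nat -> bool) n := mkseq f n.
have size_br f n : size (br f n) = n by rewrite size_mkseq.
have take_br f n : take n (br f n.+1) = br f n.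
  rewrite /br /mkseq -map_take; congr map.
  by rewrite -addn1 iotaD take_size_cat // size_iota.
have histE f n : hist n (br f n) = [seq mv i (br f i) | i <- iota 0 n.+1].
  elim: n => [//|n IH].
  have -> : iota 0 n.+2 = rcons (iota 0 n.+1) n.+1.
    by rewrite -cats1 -[n.+2]addn1 iotaD.
  by rewrite map_rcons -IH -(take_br f n).
pose O f n := (mv n (br f n)).1.
pose x f n := (mv n (br f n)).2.
have answerE f n : choquet_answer sB (O f) (x f) n = sB (hist n (br f n)).
  rewrite histE /choquet_answer; congr sB; apply: eq_map => i.
  by rewrite /O /x -surjective_pairing.
pose W f := choquet_answer sB (O f) (x f).
pose good (S : set Z) := open S /\ exists2 z, S z & big_type z.
(* A legal answer of B keeps the last point of A, whose type is big: this is what the next level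
   requires. *)
have goodW n : (forall f, (forall i, (i <= n)%N -> choquet_legalA (W f) (O f) (x f) i) /\
      big_type (x f n)) ->
    forall s, size s = n.+1 -> good (sB (hist n (take n s))).
  (* Padding with [false] extends the node [s] to a branch. *)
  move=> inv s sn; have -> : s = br (nth false s) n.+1 by rewrite /br -sn mkseq_nth.
  rewrite take_br; have [leg bx] := inv (nth false s).
  have [/(_ n leg)[Wo Wx _] _] := sBP (O (nth false s)) (x (nth false s)).
  by rewrite -answerE; split=> //; exists (x (nth false s) n).
have inv n f : (forall i, (i <= n)%N -> choquet_legalA (W f) (O f) (x f) i) /\
    big_type (x f n).
  elim: n f => [|n IH] f.
    split; last by exists e0.
    by move=> i; rewrite leqn0 => /eqP->; split=> //; exact: openT.
  have [mvP _] := stepP (n.+1, fun s' => sB (hist n (take n s'))) (goodW n IH).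
  have [mo mx mW mb] := mvP (br f n.+1) (size_br _ _).
  split=> // i; rewrite leq_eqVlt => /predU1P[->|]; last exact: (IH f).1.
  by split=> //; rewrite /W answerE -(take_br f n).
have mv_apart n s t : size s = n.+1 -> size t = n.+1 -> s != t ->
    apart n.+1 (mv n.+1 s).1 (mv n.+1 t).1.
  have [_ h] := stepP (n.+1, fun s' => sB (hist n (take n s'))) (goodW n (inv n)).
  exact: h.
have /choice[y yP] f : exists e, Y e /\ exists2 z, realizes z e & forall n, O f n z.
  have [B0 /(_ (fun n => (inv n f).1 n (leqnn n)))[z zW]] := sBP (O f) (x f).
  have [e Ye ze] := realized z; exists e; split=> //; exists z => // n.
  by have [_ _] := B0 n (inv n f).1; apply; exact: zW.
exists y; split=> [f|f g fg Efg]; first by case: (yP f).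
have [i fgi] : exists i, f i <> g i.
  by apply/existsNP => h; apply: fg; exact/funext.
have [[Yf [zf zfy Of]] [Yg [zg zgy Og]]] := (yP f, yP g).
have [k Uk] := E_U U_nf Efg.
(* Sequences of length [n.+1] include the coordinate [i], so the two nodes differ; their open sets
   are apart for [U n.+1], which contains [U k] on [X]. *)
pose n := maxn i k.
apply: (@mv_apart n (br f n.+1) (br g n.+1) _ _ _ zf zg (y f) (y g)) => //.
- apply/eqP => /(congr1 (nth false ^~ i)).
  by rewrite !nth_mkseq ?ltnS ?leq_maxl.
- exact: YX.
- exact: YX.
- exact: (Of n.+1).
- exact: (Og n.+1).
- apply: (U_mono U_nf _ _ _ Uk); [exact: YX|exact: YX|].
  exact: leq_trans (leq_maxr i k) (leqnSn _).
Qed.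

End tree.

Theorem theorem3p18 (L : language) (T : set (sentence L)) (kappa : Type)
    (M : structure L) (A : set M) (alpha : Type)
    (X Y C : set (alpha -> M))
    (E : set ((alpha -> M) * (alpha -> M)))
    (U : nat -> set ((alpha -> M) * (alpha -> M)))
    (Gamma : set (M -> M)) :
  complete_theory T ->
  monster_model kappa M T ->
  small kappa A ->
  small kappa [set: alpha] ->
  type_definable A X ->
  invariant_Fsigma_equivalence kappa X E ->
  normal_form X E U ->
  bounded_on kappa X E ->
  classes X E C ->
  ~ strongly_closed C E U ->
  C `<=` Y ->
  Y `<=` X ->
  pseudo_strong_choquet kappa Y ->
  class_union X E Y ->
  aut_subgroup Gamma ->
  transitive_on Gamma C ->
  preserves_classes Gamma X E ->
  [set: nat -> bool] #<= classes Y E.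
Proof.
move=> _ [/smallTP kappa_nat /smallTP kappa_L _ M_sat M_hom] A_small.
move=> /smallTP alpha_small X_def [_ _ E_eq] U_nf E_bounded C_class C_nsc CY YX.
move=> Y_choquet _ Gamma_group Gamma_trans Gamma_classes.
have [refl _ _] := E_eq.
have [c0 Cc0] : C !=set0.
  by have [a Xa <-] := C_class; exists a; split=> //; exact: refl.
have ball := psyndetic_U_ball kappa_nat M_sat M_hom A_small alpha_small X_def
  E_eq U_nf E_bounded C_class C_nsc Gamma_group Gamma_trans Gamma_classes Cc0.
(* The radius [n D] is selected before [K]; then [ch] selects a centre for each [D] and [K], and [N]
   is closed under the coordinates of these centres. Sets that are not piecewise syndetic get dummy
   values. *)
have /choice[n nP] (D : set (alpha -> M)) : exists n,
    psyndetic C (@act L M alpha @` Gamma) D -> forall K, exists c,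
    [/\ C c, ~ U K (c0, c) & forall D', definable set0 D' ->
      as_tuples (U n) `<=` D' ->
      psyndetic C (@act L M alpha @` Gamma) [set b | D' (pair_tuple c b) /\ D b]].
  have [/ball[n nP]|nps] := pselect (psyndetic C (@act L M alpha @` Gamma) D).
    by exists n.
  by exists 0%N => /nps.
have /choice[ch chP] (p : set (alpha -> M) * nat) : exists c,
    psyndetic C (@act L M alpha @` Gamma) p.1 ->
    [/\ C c, ~ U p.2 (c0, c) & forall D', definable set0 D' ->
      as_tuples (U (n p.1)) `<=` D' ->
      psyndetic C (@act L M alpha @` Gamma) [set b | D' (pair_tuple c b) /\ p.1 b]].
  have [/nP/(_ p.2)[c cP]|nps] :=
    pselect (psyndetic C (@act L M alpha @` Gamma) p.1); first by exists c.
  by exists c0 => /nps.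
have S_small : small kappa (A `|` range c0).
  pose par (v : set_type A + alpha) : M :=
    match v with inl c => set_val c | inr i => c0 i end.
  have : small kappa (range par).
    by apply: small_range; apply: smallT_sum => //; exact/smallP.
  apply: small_sub => c [Ac|[i _ <-]]; first by exists (inl (to_set Ac)).
  by exists (inr i).
have [N [N_elem N_small SN N_ch]] := small_model kappa_nat kappa_L
  (fun D k => ch (D, k)) alpha_small S_small.
have AN : A `<=` N by move=> c Ac; apply: SN; left.
have Nc0 i : sub_dom N (c0 i) by apply: SN; right; exists i.
have [D Ddef psD|y [Yy yE]] := strong_choquet_classes kappa_nat M_sat M_hom
  alpha_small X_def E_eq U_nf C_class Gamma_group Gamma_classes CY YX
  N_small AN Cc0 Nc0 _ (Y_choquet N N_elem N_small).
  exists (n D) => K; exists (ch (D, K)).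
  by have [? ? ?] := chP (D, K) psD; split=> // i; exact: N_ch.
apply/card_le_injP.
apply: inj_le_trans (inj_le_setT _) _.
have cl f : classes Y E [set b | Y b /\ E (y f, b)] by exists (y f).
exists (fun f => to_set (cl f)) => f g /(congr1 set_val) /= fg.
apply: contrapT => /yE; apply.
have : [set b | Y b /\ E (y g, b)] (y g) by split=> //; apply: refl; exact: YX.
by rewrite -[[set b | _]]fg => -[].
Qed.
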